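(* If $\phi$ is a reversible semiflow on $X$, then it admits a reversible Lyapunov function compactification $\hat\phi$ on $\hat X$ such that every point of $\hat X\setminus X$ is a fixed point, that is, $\hat X\setminus X\subset|\hat\phi|$. If $X$ is metrizable then the compactification can be chosen metrizable.
   Context: A space is a locally compact, $\sigma$-compact Hausdorff space; $X$ is a space. A semiflow on $X$ is a continuous $\phi:[0,\infty)\times X\to X$, $\phi^t(x)=\phi(t,x)$, with $\phi^0=1_X$ and $\phi^t\circ\phi^s=\phi^{t+s}$. It is reversible if $\phi^1$ is a homeomorphism (then every $\phi^t$ is, and $\phi$ extends to a flow). $|\phi|=\{x:\phi^t(x)=x\text{ for all }t\ge0\}$ is the fixed point set. Let $\phi^I=\bigcup_{t\in[0,1]}\phi^t\subset X\times X$ (maps identified with graphs), a closed relation; $\mathcal G\phi$ is the smallest closed transitive relation on $X$ containing $\phi^I$. $\mathcal B(X)$ is the Banach algebra of bounded continuous real functions on $X$ with the sup norm. $u\in\mathcal B(X)$ is $\phi$ uniform if for every $\epsilon>0$ there is $\delta>0$ with $|u(\phi(t,x))-u(x)|\le\epsilon$ for all $(t,x)\in[0,\delta]\times X$. A Lyapunov function for $\phi$ is $L\in\mathcal B(X)$ with $L(x)\le L(\phi^t(x))$ for all $x\in X$, $t\ge0$. With $\le_L=\{(x,y):L(x)\le L(y)\}$, a sufficient set of Lyapunov functions for $\phi$ is a set $\mathcal L$ of $\phi$ uniform Lyapunov functions with $\bigcap_{L\in\mathcal L}\le_L=\mathcal G\phi$. $\mathcal L$ is $\phi^*$ +invariant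 if $L\circ\phi^t\in\mathcal L$ for all $L\in\mathcal L$, $t\ge0$. A proper compactification of $X$ is a compact Hausdorff $\hat X$ containing $X$ as a dense (hence open) topological subspace; it corresponds to the closed subalgebra of functions in $\mathcal B(X)$ extending continuously to $\hat X$, and every closed subalgebra (containing the constants) distinguishing points from closed sets arises from a unique (up to homeomorphism) such $\hat X$. A Lyapunov function compactification for $\phi$ is the compactification $\hat X$ associated with the closed subalgebra generated by a $\phi^*$ +invariant sufficient set of Lyapunov functions for $\phi$ together with the continuous functions of compact support, equipped with the unique semiflow $\hat\phi$ on $\hat X$ extending $\phi$; it is reversible if $\hat\phi$ is reversible, and metrizable if $\hat X$ is. *)

(* Defs.v *)
From HB Require Import structures.
From mathcomp Require Import all_boot all_order all_algebra.
From mathcomp Require Import all_classical all_reals all_analysis.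

Set Implicit Arguments.
Unset Strict Implicit.
Unset Printing Implicit Defensive.

Import Order.TTheory GRing.Theory Num.Theory.
Import numFieldNormedType.Exports.

Local Open Scope classical_set_scope.
Local Open Scope ring_scope.

Definition sigma_compact (X : topologicalType) :=
  exists K : nat -> set X,
    (forall n, compact (K n)) /\ \bigcup_n K n = [set: X].

Definition homeomorphism (X Y : topologicalType) (f : X -> Y) :=
  continuous f /\
  exists g : Y -> X, [/\ cancel f g, cancel g f & continuous g].

Definition metrizable (R : realType) (X : topologicalType) :=
  exists (M : metricType R) (f : X -> M), homeomorphism f.

(* The time set is [0, +oo[: values at negative times are irrelevant. *)
Record semiflow (R : realType) (X : topologicalType) := Semiflow {
  semiflow_fun :> R -> X -> X ;
  semiflow_continuous :
    {within [set p : R * X | 0 <= p.1],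
      continuous (fun p : R * X => semiflow_fun p.1 p.2)} ;
  semiflow0 : forall x, semiflow_fun 0 x = x ;
  semiflowD : forall s t x, 0 <= s -> 0 <= t ->
    semiflow_fun t (semiflow_fun s x) = semiflow_fun (t + s) x }.

Definition bounded_continuous (R : realType) (X : topologicalType)
    : set (X -> R) :=
  [set u | continuous u /\ bounded_fun u].
Arguments bounded_continuous {R X}.

Section semiflow_notions.
Context {R : realType} {X : topologicalType} (phi : semiflow R X).

Definition reversible := homeomorphism (phi 1).

Definition fixed_points : set X :=
  [set x | forall t, 0 <= t -> phi t x = x].

Definition unit_orbit_relation : set (X * X) :=
  [set p | exists2 t, 0 <= t <= 1 & phi t p.1 = p.2].

Definition closed_transitive (F : set (X * X)) :=
  closed F /\ (forall x y z, F (x, y) -> F (y, z) -> F (x, z)).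

Definition generalized_orbit_relation : set (X * X) :=
  smallest closed_transitive unit_orbit_relation.

Definition phi_uniform (u : X -> R) :=
  forall eps, 0 < eps -> exists2 delta, 0 < delta &
    forall t x, 0 <= t <= delta -> `|u (phi t x) - u x| <= eps.

Definition lyapunov_function (L : X -> R) :=
  bounded_continuous L /\ forall x t, 0 <= t -> L x <= L (phi t x).

Definition sufficient_set (LL : set (X -> R)) :=
  (forall L, LL L -> phi_uniform L /\ lyapunov_function L) /\
  \bigcap_(L in LL) [set p : X * X | L p.1 <= L p.2] =
    generalized_orbit_relation.

Definition plus_invariant (LL : set (X -> R)) :=
  forall L t, LL L -> 0 <= t -> LL (L \o phi t).

End semiflow_notions.

Section subalgebras.
Context {R : realType} {X : topologicalType}.

Definition compactly_supported : set (X -> R) :=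
  [set u | continuous u /\ compact (closure [set x | u x != 0])].

(* Subalgebras contain the constants, hence are closed under scaling;
   {uniform X -> R} carries the sup-norm topology on the bounded functions. *)
Definition closed_subalgebra (A : set (X -> R)) :=
  [/\ A `<=` bounded_continuous,
      forall c : R, A (cst c),
      forall u v, A u -> A v -> A (u \+ v),
      forall u v, A u -> A v -> A (u \* v)
    & closed (A : set {uniform X -> R})].

Definition generated_closed_subalgebra (G : set (X -> R)) : set (X -> R) :=
  smallest closed_subalgebra G.

Definition extendable_functions (Y : topologicalType) (i : X -> Y)
    : set (X -> R) :=
  [set u | bounded_continuous u /\
           exists2 v : Y -> R, continuous v & v \o i = u].

End subalgebras.

Definition proper_compactification (X Y : topologicalType) (i : X -> Y) :=
  [/\ hausdorff_space Y, compact [set: Y],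
      injective i,
      forall U : set X, open U <-> exists2 V, open V & i @^-1` V = U
    & dense (range i)].

Record lyapunov_compactification (R : realType) (X : topologicalType)
    (phi : semiflow R X) := LyapunovCompactification {
  lc_space : topologicalType ;
  lc_emb : X -> lc_space ;
  lc_semiflow : semiflow R lc_space ;
  lc_proper : proper_compactification lc_emb ;
  lc_algebra : exists LL : set (X -> R),
    [/\ sufficient_set phi LL, plus_invariant phi LL
      & extendable_functions lc_emb =
          generated_closed_subalgebra (LL `|` compactly_supported)] ;
  lc_extends : forall t x, 0 <= t ->
    lc_semiflow t (lc_emb x) = lc_emb (phi t x) }.

(* Main.v *)
Require Import Defs.
From HB Require Import structures.
From mathcomp Require Import all_boot all_order all_algebra.
From mathcomp Require Import all_classical all_reals all_analysis.
From mathcomp Require Import ring lra.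

Set Implicit Arguments.
Unset Strict Implicit.
Unset Printing Implicit Defensive.

Import Order.TTheory GRing.Theory Num.Theory.
Import numFieldNormedType.Exports.

Local Open Scope classical_set_scope.
Local Open Scope ring_scope.

(* The relation G = generalized_orbit_relation phi is a closed preorder on a
   locally compact, sigma-compact space, so by Nachbin's ordered version of
   Urysohn's lemma the continuous G-monotone functions L : X -> [0, 1] separate
   the pairs outside G.  They have to be replaced by functions that hardly vary
   along the flow near infinity.  Extend phi to a flow psi, let f >= 1 be a
   proper function, and let T x be the infimum over s of f (psi_s x) + |s|: it
   is continuous, proper and 1-Lipschitz along orbits.  Then
     L_k x = sup_(0 <= s <= 1) (L (psi_(s T x) x) - k s)
   is a Lyapunov function with L_k (psi_t x) <= L_k x + 2 k t / T x, and L_k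
   tends to L, so the L_k are still sufficient.
   Let Y be the closure of the image of X under the map whose coordinates are
   the L_k and the compactly supported functions max(0, n - T) h.  Since the
   coordinates w satisfy w o psi_t - w -> 0 at infinity, psi extended by the
   identity on Y \ X is a continuous flow, and by Stone-Weierstrass C(Y) is the
   required algebra.  If X is metrizable, the complement of a closed relation
   is sigma-compact, hence countably many L and h suffice. *)

(** * Ordered normality and monotone Urysohn functions *)

Section locally_compact_spaces.
Context {X : topologicalType}.
Hypothesis hausX : hausdorff_space X.
Hypothesis lcX : locally_compact [set: X].

Lemma compact_sub_interior (K : set X) : compact K ->
  exists2 K', compact K' & K `<=` K'°.
Proof.
move=> /compact_near_coveringP cK.
(* The sets [A] containing a sufficiently large compact set form a filter; compactness of [K] for
   this filter replaces choosing finitely many compact neighbourhoods and uniting them. *)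
pose F := filter_from (@compact X) (fun C => [set A | C `<=` A]).
have FF : Filter F.
  apply: filter_from_filter; first by exists set0; exact: compact0.
  move=> A B cA cB; exists (A `|` B); first exact: compactU.
  by move=> C AB; split=> x Ax; apply: AB; [left|right].
have [x Kx|C cC /(_ C)] := cK _ F (fun A x => A° x) FF; last first.
  by move=> KC; exists C => //; apply: KC.
have [U nU [cU _]] := lcX (I : [set: X] x).
exists (U°, [set A | U `<=` A]) => /=.
  split; last by exists U.
  by apply: nbhs_interior; move: nU; rewrite /within /=; apply: filterS => y; apply.
by move=> [y A] /= [Uy UA]; apply: (interiorS UA).
Qed.

Lemma compact_nbhs_in_open (K O : set X) : compact K -> open O -> K `<=` O ->
  exists K', [/\ compact K', K `<=` K'° & K' `<=` O].
Proof.
move=> cK oO KO; have [C cC KC] := compact_sub_interior cK.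
have := @compact_normal_local X C hausX cC K KC (compact_closed hausX cK).
have nO : set_nbhs K O by move=> x Kx; apply: open_nbhs_nbhs; split=> //; apply: KO.
move=> /(_ _ nO)[B nB BO]; exists (closure B `&` C); split.
- apply: (subclosed_compact _ cC) => //.
  by apply: closedI; [exact: closed_closure|exact: compact_closed].
- move=> x Kx; rewrite interiorI; split; last exact: KC.
  have := nB _ Kx; apply: filterS; exact: subset_closure.
- by move=> x [/BO].
Qed.

Hypothesis scX : sigma_compact X.

Lemma compact_exhaustion : exists E : nat -> set X,
  [/\ E 0 = set0, forall n, compact (E n), forall n, E n `<=` (E n.+1)°
    & forall x, exists n, E n x].
Proof.
have [K [cK KT]] := scX.
have nxt (C : set X) : exists C', compact C -> compact C' /\ C `<=` C'°.
  have [cC|?] := pselect (compact C); last by exists C.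
  by have [C' ? ?] := compact_sub_interior cC; exists C'.
pose f C := projT1 (cid (nxt C)).
have fP C : compact C -> compact (f C) /\ C `<=` (f C)° := projT2 (cid (nxt C)).
pose E := fix E n := if n is m.+1 then f (E m `|` K m) else set0.
have cE n : compact (E n).
  elim: n => [|n IH] /=; first exact: compact0.
  by apply: (fP _ _).1; apply: compactU.
have EU n : E n `|` K n `<=` (E n.+1)° by apply: (fP _ _).2; exact: compactU.
exists E; split=> // [n x Ex|x]; first by apply: EU; left.
have : (\bigcup_n K n) x by rewrite KT.
move=> [n _ Kx]; exists n.+1; apply: interior_subset; apply: EU; by right.
Qed.

End locally_compact_spaces.

Section closed_preorders.
Context {X : topologicalType}.
Implicit Types (E : set (X * X)) (A B F U W : set X).

Definition converse E : set (X * X) := [set p | E (p.2, p.1)].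

Definition preorder_relation E :=
  (forall x, E (x, x)) /\ (forall x y z, E (x, y) -> E (y, z) -> E (x, z)).

Definition lower_set E A := forall x y, E (x, y) -> A y -> A x.

Definition lower_closure E A := [set x | exists2 a, A a & E (x, a)].

Lemma closed_converse E : closed E -> closed (converse E).
Proof.
move=> cE; have := @swap_continuous X X; rewrite continuous_closedP.
exact.
Qed.

Lemma preorder_converse E : preorder_relation E -> preorder_relation (converse E).
Proof. by move=> [rE tE]; split=> // x y z /= xy yz; exact: tE yz xy. Qed.

Lemma lower_setC E A : lower_set E A -> lower_set (converse E) (~` A).
Proof. by move=> lA x y /= Eyx nAy /(lA _ _ Eyx). Qed.

(** A tube argument: if [x] is below no point of [A], each [a] in [A] has a product neighbourhood of
    [(x, a)] off [E], and compactness of [A] gives one neighbourhood of [x] for all of them. *)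
Lemma closed_lower_closure E A : closed E -> compact A -> closed (lower_closure E A).
Proof.
move=> cE /compact_near_coveringP cA; rewrite -[lower_closure E A]setCK.
apply: open_closedC; rewrite openE => x nAx; rewrite /interior.
have : \forall x' \near x, A `<=` (fun a => ~ E (x', a)).
  have := cA _ (nbhs x) (fun x' a => ~ E (x', a)); apply=> a Aa.
  have : nbhs (x, a) (~` E).
    apply: open_nbhs_nbhs; split; first exact: closed_openC.
    by move=> Exa; apply: nAx; exists a.
  move=> [[P Q] /= [nP nQ] PQ]; exists (Q, P) => //= -[a' x'] /= [Qa Px].
  by apply: (PQ (x', a')).
by apply: filterS => x' h [a Aa Exa]; exact: h Exa.
Qed.

Lemma sub_lower_closure E A : preorder_relation E -> A `<=` lower_closure E A.
Proof. by move=> [rE _] x Ax; exists x. Qed.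

End closed_preorders.

Section ordered_normality.
Context {X : topologicalType}.
Hypothesis hausX : hausdorff_space X.
Hypothesis lcX : locally_compact [set: X].

Let lower_trace (E : set (X * X)) (K F A : set X) :=
  [/\ compact A, A `<=` K, F `&` K `<=` A
    & forall x y, K x -> E (x, y) -> A y -> A x].

(** Fatten [A] and [F] inside [K'] to a compact neighbourhood off [C] and take its lower closure,
    which is closed by compactness and still misses [C] because [C] is an upper set. *)
Let trace_step (E : set (X * X)) (K K' F A C : set X) :
  closed E -> preorder_relation E -> compact K' -> K `<=` K'° -> closed F ->
  lower_trace E K F A -> closed C -> lower_set (converse E) C ->
  (A `|` (F `&` K')) `&` C = set0 ->
  exists A', [/\ lower_trace E K' F A', A `<=` A'° & A' `&` C = set0].
Proof.
move=> cE pE cK' KK' cF [cA AK FA lA] cC uC AC.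
have cAF : compact (A `|` (F `&` K')).
  apply: compactU => //; rewrite setIC; apply: compact_closedI => //.
have [||A1 [cA1 AA1 A1C]] :=
    @compact_nbhs_in_open X hausX lcX (A `|` (F `&` K')) (~` C) cAF.
- exact: closed_openC.
- move=> x AFx Cx; have : ((A `|` (F `&` K')) `&` C) x by [].
  by rewrite AC.
exists (lower_closure E A1 `&` K'); split; last 2 first.
- move=> x Ax; rewrite interiorI; split; last exact/KK'/AK.
  apply: (interiorS (sub_lower_closure pE)); apply: AA1; by left.
- rewrite -subset0 => x [[[a A1a xa] K'x] Cx].
  by apply: (A1C a A1a); apply: uC Cx.
split=> //.
- rewrite setIC; apply: compact_closedI => //; exact: closed_lower_closure.
- move=> x [Fx K'x]; split=> //; apply: sub_lower_closure => //.
  by apply: interior_subset; apply: AA1; right.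
- move=> x y K'x xy [[a A1a ya] _]; split=> //; exists a => //.
  exact: pE.2 xy ya.
Qed.

Hypothesis scX : sigma_compact X.

(* [A] is the union of compact sets [A_n] which are lower relative to the [n]th
   set of an exhaustion only; the union is lower because the exhaustion covers
   [X], even though the lower closure of a closed set need not be closed. *)
Lemma ordered_normal (E : set (X * X)) (F W : set X) :
  closed E -> preorder_relation E -> closed F -> lower_set E F ->
  closed W -> lower_set (converse E) W -> F `&` W = set0 ->
  exists A B, [/\ open A /\ open B, lower_set E A, lower_set (converse E) B,
    F `<=` A /\ W `<=` B & A `&` B = set0].
Proof.
move=> cE pE cF lF cW uW FW.
have [K [K0 cK KS KT]] := compact_exhaustion lcX scX.
(* The last clause, no point of [B] below a point of [A], is stronger than disjointness and is what
   survives taking closures under [E]. *)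
pose P n (AB : set X * set X) := [/\ lower_trace E (K n) F AB.1,
  lower_trace (converse E) (K n) W AB.2 &
  forall b a, AB.2 b -> AB.1 a -> ~ E (b, a)].
have P0 : P 0%N (set0, set0).
  by split=> //=; split; rewrite ?K0 ?setI0//=; exact: compact0.
have step n AB : exists AB', P n AB ->
    [/\ P n.+1 AB', AB.1 `<=` AB'.1° & AB.2 `<=` AB'.2°].
  have [PAB|?] := pselect (P n AB); last by exists AB.
  case: AB PAB => A B [/= PA PB BA].
  have [cA AK FA lA] := PA; have [cB BK WB uB] := PB.
  pose BW := B `|` (W `&` K n.+1).
  have cBW : compact BW.
    apply: compactU => //; rewrite setIC; exact: compact_closedI.
  (* This is the upper closure of what the next [B] has to contain. Keeping [A'] off it leaves room
     for [B'], which is then built off the lower closure of [A']. *)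
  pose C := lower_closure (converse E) BW.
  have pE' := preorder_converse pE; have cE' := closed_converse cE.
  have [|||A' [PA' AA' A'C]] :=
    trace_step (C := C) cE pE (cK n.+1) (KS n) cF PA.
  - exact: closed_lower_closure.
  - by move=> x y yx [b ? bx]; exists b => //; exact: pE'.2 yx bx.
  - rewrite -subset0 => a [AF [b BWb /= ba]].
    case: AF BWb => [Aa|[Fa _]] [Bb|[Wb _]].
    + exact: BA ba.
    (* The point [a] lies in the upper set [W] and, being in [A], already in [K n]; hence it is in
       [B] as well, against the invariant and reflexivity. *)
    + have Ba : B a by apply: WB; split; [exact: uW ba Wb|exact: AK].
      by apply: (BA a a) => //; exact: pE.1.
    + have Ab : A b by apply: FA; split; [exact: lF ba Fa|exact: BK].
      by apply: (BA b b) => //; exact: pE.1.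
    + by have : (F `&` W) a by [split=> //; exact: uW ba Wb]; rewrite FW.
  have [cA' _ _ _] := PA'.
  have [|||B' [PB' BB' B'D]] :=
    trace_step (C := lower_closure E A') cE' pE' (cK n.+1) (KS n) cW PB.
  - exact: closed_lower_closure.
  - by move=> x y yx [b ? bx]; exists b => //; exact: pE.2 yx bx.
  - rewrite -subset0 => b [BWb [a A'a ba]].
    have : (A' `&` C) a by split=> //; exists b.
    by rewrite A'C.
  exists (A', B') => _; split=> //; split=> // b a /= B'b A'a ba.
  have : (B' `&` lower_closure E A') b by split=> //; exists a.
  by rewrite B'D.
pose f n AB := projT1 (cid (step n AB)).
have fP n AB := projT2 (cid (step n AB)).
pose S := fix S n := if n is m.+1 then f m (S m) else (set0, set0).
have SP n : P n (S n).
  by elim: n => [//|n IH] /=; have [] := fP n (S n) IH.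
have S1 n : (S n).1 `<=` ((S n.+1).1)° by have [] := fP n (S n) (SP n).
have S2 n : (S n).2 `<=` ((S n.+1).2)° by have [] := fP n (S n) (SP n).
have le1 m n : (m <= n)%N -> (S m).1 `<=` (S n).1.
  elim: n => [|n IH]; first by rewrite leqn0 => /eqP ->.
  rewrite leq_eqVlt => /predU1P[->//|/IH h] x /h /S1; exact: interior_subset.
have le2 m n : (m <= n)%N -> (S m).2 `<=` (S n).2.
  elim: n => [|n IH]; first by rewrite leqn0 => /eqP ->.
  rewrite leq_eqVlt => /predU1P[->//|/IH h] x /h /S2; exact: interior_subset.
have leK m n : (m <= n)%N -> K m `<=` K n.
  elim: n => [|n IH]; first by rewrite leqn0 => /eqP ->.
  rewrite leq_eqVlt => /predU1P[->//|/IH h] x /h /KS; exact: interior_subset.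
exists (\bigcup_n (S n).1), (\bigcup_n (S n).2); split.
- split; rewrite openE => x [n _ Snx]; apply: filterS (bigcup_sup (I : setT n.+1)) _.
    exact: S1.
  exact: S2.
- move=> x y xy [n _ Sny]; have [m Kmx] := KT x; exists (maxn m n) => //.
  have [[_ _ _ l] _ _] := SP (maxn m n); apply: l xy _.
    by apply: leK Kmx; rewrite leq_maxl.
  by apply: le1 Sny; rewrite leq_maxr.
- move=> x y xy [n _ Sny]; have [m Kmx] := KT x; exists (maxn m n) => //.
  have [_ [_ _ _ l] _] := SP (maxn m n); apply: l xy _.
    by apply: leK Kmx; rewrite leq_maxl.
  by apply: le2 Sny; rewrite leq_maxr.
- split=> x ?; have [n Knx] := KT x; exists n => //;
    by have [[_ _ h1 _] [_ _ h2 _] _] := SP n; first [apply: h1|apply: h2].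
- rewrite -subset0 => x [[n _ Snx] [m _ Smx]].
  have [_ _ /(_ x x)] := SP (maxn m n); apply; last exact: pE.1.
    by apply: le2 Smx; rewrite leq_maxl.
  by apply: le1 Snx; rewrite leq_maxr.
Qed.

End ordered_normality.

Section real_continuity.
Context {R : realType}.

Lemma continuous_realP (T : topologicalType) (f : T -> R) :
  (forall x e, 0 < e -> \forall y \near x, `|f y - f x| <= e) -> continuous f.
Proof.
move=> h x; apply/cvgrPdist_le => e e0; near=> y.
by rewrite distrC; near: y; exact: h.
Unshelve. all: by end_near. Qed.

Lemma near_dist (T : topologicalType) (f : T -> R) x e : continuous f ->
  0 < e -> \forall y \near x, `|f y - f x| <= e.
Proof.
move=> /(_ x)/cvgrPdist_le h e0; near=> y.
by rewrite distrC; near: y; exact: h.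
Unshelve. all: by end_near. Qed.

Lemma exp_half_lt (e : R) : 0 < e -> exists n, (2^-1) ^+ n < e.
Proof.
move=> e0; have h : (2^-1 : R) ^+ n @[n --> \oo] --> (0 : R).
  by apply: cvg_expr; rewrite ger0_norm ?invr_ge0// invf_lt1 ?ltr1n.
have /cvgrPdist_lt/(_ e e0)[N _ /(_ N (leqnn N))] := h.
by rewrite /= sub0r normrN ger0_norm ?exprn_ge0// => ?; exists N.
Qed.

End real_continuity.

Section ordered_urysohn.
Context {R : realType} {X : topologicalType}.
Hypothesis hausX : hausdorff_space X.
Hypothesis lcX : locally_compact [set: X].
Hypothesis scX : sigma_compact X.
Variable E : set (X * X).
Hypothesis cE : closed E.
Hypothesis pE : preorder_relation E.

Let good (F U : set X) :=
  [/\ closed F /\ lower_set E F, open U /\ lower_set E U & F `<=` U].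

(** Ordered normality for [F] and the complement of [U]: [VC.1] is the open lower set and [VC.2] the
    complement of the open upper one. The pair [(F, F)] is a dummy value that makes the choice
    total. *)
Let interpolate F U : exists VC : set X * set X,
  good F U -> [/\ good F VC.1, good VC.2 U & VC.1 `<=` VC.2].
Proof.
have [|?] := pselect (good F U); last by exists (F, F).
move=> [[cF lF] [oU lU] FU].
have [|||A [B [[oA oB] lA uB [FA UB] AB]]] :=
    ordered_normal hausX lcX scX cE pE cF lF (_ : closed (~` U)) _ _.
- exact: open_closedC.
- exact: lower_setC.
- by rewrite -subset0 => x [/FU].
exists (A, ~` B) => _ /=; have lB := lower_setC uB.
split=> [||x Ax Bx]; [by []| |by have : (A `&` B) x by []; rewrite AB].
split=> //; first by split; [exact: open_closedC|].
by move=> x nBx; apply: contrapT => /UB.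
Qed.

Let V F U := (projT1 (cid (interpolate F U))).1.
Let C F U := (projT1 (cid (interpolate F U))).2.

Let VCP F U : good F U -> [/\ good F (V F U), good (C F U) U & V F U `<=` C F U].
Proof. exact: (projT2 (cid (interpolate F U))). Qed.

(* Since [h n F (V F U)] is [1] off [V F U] and [h n (C F U) U] is [0] on
   [C F U], which contains [V F U], at each point at most one of the two
   summands differs from its constant value: oscillations and increments are
   halved at each step. *)
Let h := fix h n (F U : set X) (x : X) : R :=
  if n is m.+1 then (h m F (V F U) x + h m (C F U) U x) / 2 else \1_(~` U) x.

Let hS n F U x : h n.+1 F U x = (h n F (V F U) x + h n (C F U) U x) / 2.
Proof. by []. Qed.

Let h_bounds n F U x : good F U ->
  [/\ 0 <= h n F U x <= 1, F x -> h n F U x = 0 & ~ U x -> h n F U x = 1].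
Proof.
elim: n F U => [|n IH] F U gFU.
  rewrite /= indicE; split; first by case: (_ \in _); rewrite ?lexx ler01.
    by move=> Fx; have [_ _ /(_ _ Fx) Ux] := gFU; rewrite memNset// => /(_ Ux).
  by move=> nUx; rewrite mem_set.
have [g1 g2 VC] := VCP gFU.
have [/andP[a0 a1] aF aV] := IH _ _ g1; have [/andP[b0 b1] bF bU] := IH _ _ g2.
have [_ _ FV] := g1; have [_ _ CU] := g2.
rewrite hS; split=> [|Fx|nUx].
- by apply/andP; split; lra.
- by rewrite aF// bF ?addr0 ?mul0r//; apply: VC; exact: FV.
- rewrite aV ?bU//; first by lra.
  by move=> /VC /CU.
Qed.

Let h_mono n F U x y : good F U -> E (x, y) -> h n F U x <= h n F U y.
Proof.
move=> + xy; elim: n F U => [|n IH] F U gFU.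
  rewrite /=; have [_ [_ lU] _] := gFU; rewrite !indicE ler_nat.
  have [nUx|//] := boolP (x \in ~` U); rewrite mem_set// => Uy.
  by move: nUx; rewrite inE; apply; exact: lU Uy.
have [g1 g2 VC] := VCP gFU.
by rewrite !hS ler_pM2r ?invr_gt0// lerD//; exact: IH.
Qed.

Let h_step n F U x : good F U ->
  h n F U x <= h n.+1 F U x <= h n F U x + 2^-1 ^+ n.+1.
Proof.
elim: n F U => [|n IH] F U gFU.
  have [g1 g2 VC] := VCP gFU; have [_ _ CU] := g2; have [_ _ FV] := g1.
  rewrite /= expr1 !indicE; have [Ux|nUx] := pselect (U x).
    rewrite (memNset (A := ~` U)) => [|/(_ Ux)//].
    by case: (_ \in _); rewrite /= ?mulr0n ?mulr1n; apply/andP; split; lra.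
  rewrite !(mem_set (A := ~` _))//; last by move=> /VC /CU.
  by rewrite /= ?mulr1n; apply/andP; split; lra.
have [g1 g2 VC] := VCP gFU; have [_ _ CU] := g2; have [_ _ FV] := g1.
have /andP[a1 a2] := IH _ _ g1; have /andP[b1 b2] := IH _ _ g2.
rewrite (hS n.+1) (hS n) exprS; have [Cx|nCx] := pselect (C F U x).
  have [_ /(_ Cx) z1 _] := h_bounds n x g2.
  have [_ /(_ Cx) z2 _] := h_bounds n.+1 x g2.
  by rewrite z1 z2; apply/andP; split; lra.
have nVx : ~ V F U x by move=> /VC.
have [_ _ /(_ nVx) z1] := h_bounds n x g1.
have [_ _ /(_ nVx) z2] := h_bounds n.+1 x g1.
by rewrite z1 z2; apply/andP; split; lra.
Qed.

Let h_osc n F U x : good F U ->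
  \forall y \near x, `|h n F U y - h n F U x| <= 2^-1 ^+ n.
Proof.
elim: n F U => [|n IH] F U gFU.
  apply: nearW => y; rewrite expr0.
  have [/andP[a0 a1] _ _] := h_bounds 0 x gFU.
  have [/andP[b0 b1] _ _] := h_bounds 0 y gFU.
  by rewrite ler_norml; apply/andP; split; lra.
have [g1 g2 VC] := VCP gFU.
have [Vx|nVx] := pselect (V F U x).
  have [_ [oV _] _] := g1.
  near=> y; have Vy : V F U y by near: y; exact: open_nbhs_nbhs.
  have : `|h n F (V F U) y - h n F (V F U) x| <= 2^-1 ^+ n.
    by near: y; exact: IH.
  have [_ /(_ (VC _ Vx)) z1 _] := h_bounds n x g2.
  have [_ /(_ (VC _ Vy)) z2 _] := h_bounds n y g2.
  rewrite !hS z1 z2 exprS !ler_norml => /andP[? ?]; apply/andP; split; lra.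
have [_ _ /(_ nVx) a1] := h_bounds n x g1.
have [Cx|nCx] := pselect (C F U x); last first.
  have [[cC _] _ _] := g2.
  near=> y; have Cy : (~` C F U) y.
    by near: y; apply: open_nbhs_nbhs; split=> //; exact: closed_openC.
  have : `|h n (C F U) U y - h n (C F U) U x| <= 2^-1 ^+ n.
    by near: y; exact: IH.
  have [_ _ z2] := h_bounds n y g1.
  rewrite !hS a1 z2 ?exprS ?ler_norml; last by move=> /VC.
  by move=> /andP[? ?]; apply/andP; split; lra.
(* Now [x] is in [C F U] but off [V F U], and both summands may vary nearby. Yet each [y] is in
   [C F U], where the second summand stays 0, or off [V F U], where the first stays 1. *)
have [_ /(_ Cx) b0 _] := h_bounds n x g2.
near=> y.
have : `|h n (C F U) U y - h n (C F U) U x| <= 2^-1 ^+ n by near: y; exact: IH.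
have : `|h n F (V F U) y - h n F (V F U) x| <= 2^-1 ^+ n by near: y; exact: IH.
have [/andP[? ?] _ Vy] := h_bounds n y g1.
have [/andP[? ?] Cy _] := h_bounds n y g2.
rewrite !hS a1 b0 exprS !ler_norml => /andP[? ?] /andP[? ?].
have [/Cy Cy0|/(contra_not (@VC y)) /Vy Vy1] := pselect (C F U y).
  by apply/andP; split; lra.
by apply/andP; split; lra.
Unshelve. all: by end_near. Qed.

Lemma ordered_urysohn (F W : set X) : closed F -> lower_set E F ->
  closed W -> lower_set (converse E) W -> F `&` W = set0 ->
  exists L : X -> R, [/\ continuous L, forall x, 0 <= L x <= 1,
    forall x, F x -> L x = 0, forall x, W x -> L x = 1
    & forall x y, E (x, y) -> L x <= L y].
Proof.
move=> cF lF cW uW FW.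
have gFW : good F (~` W).
  split=> //; last first.
    by move=> x Fx Wx; have : (F `&` W) x by []; rewrite FW.
  by split; [exact: closed_openC|exact: lower_setC uW].
pose k n := h n F (~` W).
have kb n x : 0 <= k n x <= 1 by have [] := h_bounds n x gFW.
(* The upper bound is the geometric sum of the step errors in closed form, so that induction on [d]
   closes. *)
have kle n d x : k n x <= k (n + d)%N x <= k n x + 2^-1 ^+ n - 2^-1 ^+ (n + d).
  elim: d => [|d /andP[h1 h2]]; first by rewrite addn0; apply/andP; split; lra.
  have /andP[] := h_step (n + d) x gFW; rewrite -!/(k _ _) addnS exprS => h3 h4.
  by apply/andP; split; lra.
have kle' n m x : k m x <= k n x + 2^-1 ^+ n.
  have e0 i : 0 <= (2^-1 : R) ^+ i by rewrite exprn_ge0.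
  have [/subnKC <-|/ltnW/subnKC <-] := leqP n m.
    by have /andP[_] := kle n (m - n)%N x; have := e0 (n + (m - n))%N; lra.
  have := e0 (m + (n - m))%N.
  by have /andP[] := kle m (n - m)%N x; lra.
(* The [k n] increase with error at most [2^-1 ^+ n] uniformly in [x], so their supremum inherits
   their small oscillation. *)
pose S x := [set k n x | n in [set: nat]].
have supS x : has_sup (S x).
  split; first by exists (k 0 x), 0%N.
  by exists 1 => _ [n _ <-]; have /andP[] := kb n x.
pose L x := sup (S x).
have kL n x : k n x <= L x by apply: sup_upper_bound => //; exists n.
have Lk n x : L x <= k n x + 2^-1 ^+ n.
  by apply: ge_sup; [exact: (supS x).1|move=> _ [m _ <-]].
exists L; split.
- apply: continuous_realP => x e e0.
  have [|n ne] := @exp_half_lt R (e / 2); first by rewrite divr_gt0.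
  have := h_osc n x gFW; apply: filterS => y; rewrite -!/(k _ _) !ler_norml.
  move=> /andP[? ?]; have := kL n x; have := kL n y; have := Lk n x.
  by have := Lk n y => ? ? ? ?; apply/andP; split; lra.
- move=> x; rewrite (le_trans _ (kL 0%N x)) /=; last by case/andP: (kb 0%N x).
  by apply: ge_sup; [exact: (supS x).1|move=> _ [n _ <-]; case/andP: (kb n x)].
- move=> x Fx; rewrite /L (_ : S x = [set 0]) ?sup1//.
  apply/seteqP; split=> [_ [n _ <-]|_ ->]; last exists 0%N => //.
    by have [_ h0 _] := h_bounds n x gFW; exact: h0.
  by have [_ h0 _] := h_bounds 0 x gFW; exact: h0.
- move=> x Wx; have nWx : ~ (~` W) x by [].
  rewrite /L (_ : S x = [set 1]) ?sup1//.
  apply/seteqP; split=> [_ [n _ <-]|_ ->]; last exists 0%N => //.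
    by have [_ _ h1] := h_bounds n x gFW; exact: h1.
  by have [_ _ h1] := h_bounds 0 x gFW; exact: h1.
- move=> x y xy; apply: ge_sup; first exact: (supS x).1.
  move=> _ [n _ <-]; apply: le_trans (kL n y); exact: h_mono.
Qed.

(** Urysohn's lemma for the lower closure of [y] and the upper closure of [x]: both are closed since
    points are compact, and a common point would give [E (x, y)] by transitivity. *)
Lemma nachbin_separation (x y : X) : ~ E (x, y) ->
  exists L : X -> R, [/\ continuous L, forall z, 0 <= L z <= 1, L y < L x
    & forall z w, E (z, w) -> L z <= L w].
Proof.
move=> nxy; have [rE tE] := pE.
have [|||L [cL bL L0 L1 mL]] :=
    ordered_urysohn (closed_lower_closure cE (@compact_set1 _ y)) _
      (closed_lower_closure (closed_converse cE) (@compact_set1 _ x)).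
- by move=> u v uv [_ -> vy]; exists y => //; exact: tE uv vy.
- by move=> u v /= vu [_ -> /= xv]; exists x => //; exact: tE xv vu.
- rewrite -subset0 => z [[_ -> zy] [_ -> /= xz]]; exact: nxy (tE _ _ _ xz zy).
exists L; split=> //; rewrite L0 ?L1 ?ltr01//; last by exists y.
by exists x => //=.
Qed.

End ordered_urysohn.

(** * The flow and its escape time *)

Definition continuous_flow (R : realType) (X : topologicalType)
    (psi : R -> X -> X) :=
  [/\ continuous (fun p : R * X => psi p.1 p.2), forall x, psi 0 x = x
    & forall s t x, psi s (psi t x) = psi (s + t) x].

Lemma continuous_pair (S T U : topologicalType) (f : S -> T) (g : S -> U) :
  continuous f -> continuous g -> continuous (fun x => (f x, g x)).
Proof. by move=> cf cg x; apply: cvg_pair; [exact: cf|exact: cg]. Qed.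

Section extension_to_flow.
Context {R : realType} {X : topologicalType} (phi : semiflow R X).
Hypothesis rev_phi : reversible phi.

(** With [g] the inverse of [phi 1], set [psi t x = phi (t + n) (g^n x)] for any [n] with [t + n]
    nonnegative; the value is the same for all such [n]. *)
Lemma reversible_flow : exists psi : R -> X -> X, continuous_flow psi /\
  forall t x, 0 <= t -> psi t x = phi t x.
Proof.
have [cphi1 [g [gK Kg cg]]] := rev_phi.
have shift (t : R) n d x : 0 <= t + n%:R ->
    phi (t + (n + d)%:R) (iter (n + d) g x) = phi (t + n%:R) (iter n g x).
  move=> tn; elim: d => [|d IH]; first by rewrite addn0.
  rewrite addnS iterS -IH -[X in _ = phi _ X](Kg (iter (n + d) g x)).
  rewrite semiflowD ?ler01//; last by rewrite natrD; have := ler0n R d; lra.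
  by rewrite -natr1 addrA.
have indep (t : R) n m x : 0 <= t + n%:R -> 0 <= t + m%:R ->
    phi (t + n%:R) (iter n g x) = phi (t + m%:R) (iter m g x).
  move=> tn tm; have [nm|/ltnW mn] := leqP n m.
    by rewrite -(subnKC nm) shift.
  by rewrite -(subnKC mn) shift.
pose N (t : R) := Num.bound `|t|.
have NP t : 0 <= t + (N t)%:R.
  by have := archi_boundP (normr_ge0 t); rewrite ltr_norml => /andP[]; lra.
pose psi t x := phi (t + (N t)%:R) (iter (N t) g x).
have psiE t n x : 0 <= t + n%:R -> psi t x = phi (t + n%:R) (iter n g x).
  by move=> tn; exact: indep.
have gphi t x : 0 <= t -> g (phi t x) = phi t (g x).
  move=> t0; rewrite -{1}(Kg x) semiflowD ?ler01// addrC -semiflowD ?ler01 ?gK//.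
have iter_phi n t x : 0 <= t -> iter n g (phi t x) = phi t (iter n g x).
  by move=> t0; elim: n => [//|n IH]; rewrite iterS IH gphi.
have citer n : continuous (iter n g).
  elim: n => [|n IH] x; first exact: cvg_id.
  by rewrite /=; apply: continuous_comp; [exact: IH|exact: cg].
have psi_phi t x : 0 <= t -> psi t x = phi t x.
  by move=> t0; rewrite (psiE _ 0%N) ?addr0.
exists psi; split=> //; split.
(* The extra unit makes [t0 + n] positive, so that one [n] serves near [t0] and times stay in the
   open half-line, where continuity within the half-line is plain continuity. *)
- move=> [t0 x0]; pose n := (N t0).+1.
  have : \forall p \near (t0, x0), 0 <= p.1 + n%:R.
    exists ([set t : R | 0 < t + n%:R], setT) => /=; last first.
      by move=> [t x] /= [/ltW].
    split; last exact: filterT.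
    apply: (@open_nbhs_nbhs R); split; last first.
      by rewrite /= /n -natr1; have := NP t0; lra.
    rewrite (_ : [set t : R | _] = [set t : R | - n%:R < t]); last first.
      by apply/seteqP; split=> t /=; lra.
    exact: open_gt.
  move=> near_n.
  apply: (@cvg_trans _ ((fun p : R * X => phi (p.1 + n%:R) (iter n g p.2)) @ (t0, x0))).
    apply: near_eq_cvg; apply: filterS near_n => p p0 /=; apply/esym; exact: psiE.
  rewrite /= (psiE _ n); last by rewrite /n -natr1; have := NP t0; lra.
  have c1 : {for (t0, x0), continuous
      (fun p : R * X => (p.1 + n%:R, iter n g p.2))}.
    apply: continuous_pair => p.
      by apply: cvgD; [exact: cvg_fst|exact: cvg_cst].
    by apply: (cvg_comp _ _ (@cvg_snd _ _ _ _ _)); exact: citer.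
  apply: (continuous_comp c1 (g := fun p : R * X => phi p.1 p.2)).
  have := @semiflow_continuous R X phi.
  pose P := [set p : R * X | 0 < p.1].
  have oP : open P.
    apply: (@open_comp _ _ (@fst R X) [set t | 0 < t]).
      by move=> p _; exact: cvg_fst.
    exact: open_gt.
  move=> /(@continuous_subspaceW _ _ P) h.
  have : {within P, continuous (fun p : R * X => phi p.1 p.2)}.
    by apply: h => p /= /ltW.
  rewrite continuous_open_subspace//; apply.
  by rewrite inE /P /= /n -natr1; have := NP t0; lra.
- by move=> x; rewrite psi_phi// semiflow0.
- move=> s t x; pose n := (N s + N t)%N.
  have sn : 0 <= s + n%:R.
    by rewrite natrD; have := NP s; have := ler0n R (N t); lra.
  have tn : 0 <= t + n%:R.
    by rewrite natrD; have := NP t; have := ler0n R (N s); lra.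
  have stn : 0 <= s + t + (n + n)%:R by rewrite natrD; lra.
  rewrite (psiE s n)// (psiE t n)// (psiE (s + t) (n + n)%N)//.
  by rewrite iter_phi// semiflowD// -iterD natrD addrACA.
Qed.

End extension_to_flow.

Section proper_time.
Context {R : realType} {X : topologicalType}.
Hypothesis hausX : hausdorff_space X.
Hypothesis lcX : locally_compact [set: X].
Hypothesis scX : sigma_compact X.

(** Equality is thus a closed preorder, for which the ordered lemmas become the classical ones. *)
Lemma closed_diagonal : closed [set p : X * X | p.1 = p.2].
Proof.
rewrite -[X in closed X]setCK; apply: open_closedC; rewrite openE.
move=> [x y] /= /eqP; move: hausX; rewrite open_hausdorff => h /h.
move=> [[A B] /= [xA yB] [oA oB /eqP AB]]; rewrite /interior.
exists (A, B) => /=.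
  by split; apply: open_nbhs_nbhs; split=> //; exact: set_mem.
move=> [u v] /= [Au Bv] uv; have : (A `&` B) u by split=> //; rewrite uv.
by rewrite AB.
Qed.

(** One plus a sum of Urysohn functions, the [n]th vanishing on [K n] and equal to 1 off [K n.+1]:
    the sum is locally finite and counts how many sets of the exhaustion a point has left. *)
Lemma proper_function : exists f : X -> R, [/\ continuous f, forall x, 1 <= f x
  & forall a, exists2 K, compact K & forall x, f x <= a -> K x].
Proof.
have [K [K0 cK KS KT]] := compact_exhaustion lcX scX.
have pD : preorder_relation [set p : X * X | p.1 = p.2] by split=> //= x y z -> ->.
have lD A : lower_set [set p : X * X | p.1 = p.2] A by move=> x y /= ->.
have lD' A : lower_set (converse [set p : X * X | p.1 = p.2]) A.
  by move=> x y; rewrite /converse /= => ->.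
have clK n : closed (K n) by apply: compact_closed.
have sep n : exists h : X -> R, [/\ continuous h, forall x, 0 <= h x <= 1,
    forall x, K n x -> h x = 0 & forall x, ~ K n.+1 x -> h x = 1].
  have [|||h [ch bh h0 h1 _]] := ordered_urysohn (R := R) hausX lcX scX
    closed_diagonal pD (clK n) (lD _) (_ : closed (~` (K n.+1)°)).
  - by apply: open_closedC; exact: open_interior.
  - exact: lD'.
  - by rewrite -subset0 => x [/KS].
  exists h; split=> // x nKx; apply: h1 => /interior_subset.
  exact: nKx.
have [h hP] := choice sep.
have le m n : (m <= n)%N -> K m `<=` K n.
  elim: n => [|n IH]; first by rewrite leqn0 => /eqP ->.
  rewrite leq_eqVlt => /predU1P[->//|/IH k] x /k /KS; exact: interior_subset.
have [N NP] := choice KT.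
pose g n (x : X) := 1 + \sum_(i < n) h i x.
have gS n x : g n.+1 x = g n x + h n x by rewrite /g big_ord_recr /= addrA.
have h0 n x : 0 <= h n x by have [_ /(_ x)/andP[]] := hP n.
have g1 n x : 1 <= g n x by rewrite lerDl sumr_ge0.
(* All terms of index at least [n] vanish on [K n], so any truncation beyond that gives the same
   value. *)
have gE n x : K n x -> g (N x) x = g n x.
  move=> Kx; have key m d : K m x -> g (m + d)%N x = g m x.
    move=> Km; elim: d => [|d IH]; first by rewrite addn0.
    rewrite addnS gS IH; have [_ _ -> //] := hP (m + d)%N; first by rewrite addr0.
    by apply: le Km; rewrite leq_addr.
  have [nm|/ltnW nm] := leqP n (N x).
    by rewrite -(subnKC nm) key.
  by rewrite -[in RHS](subnKC nm) key.
exists (fun x => g (N x) x); split=> //.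
  apply: continuous_realP => x e e0.
  have cg n : continuous (g n).
    elim: n => [|n IH] y.
      rewrite (_ : g 0%N = cst 1); first exact: cvg_cst.
      by apply/funext => z; rewrite /g big_ord0 addr0.
    rewrite (_ : g n.+1 = g n \+ h n); last by apply/funext => z; rewrite gS.
    by apply: cvgD; [exact: IH|have [+ _ _ _] := hP n; apply].
  have nx : nbhs x (K (N x).+1) by exact: KS.
  have := near_dist x (cg (N x).+1) e0; apply: filterS2 nx => y Ky.
  have Kx : K (N x).+1 x by apply: interior_subset; exact: KS.
  by rewrite (gE _ _ Ky) (gE _ _ Kx).
move=> a; pose m := Num.bound `|a|; exists (K m) => // x.
have am : a < m%:R.
  by apply: le_lt_trans (ler_norm a) _; exact: archi_boundP.
apply: contraPP => nKx; apply/negP; rewrite -ltNge; apply: lt_le_trans am _.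
have mN : (m <= N x)%N.
  by rewrite leqNgt; apply/negP => /ltnW/le /(_ _ (NP x)).
(* Off [K m] each of the first [m] terms is 1. *)
suff key k : (k <= m)%N -> k%:R <= g k x.
  apply: le_trans (key m (leqnn m)) _.
  rewrite -(subnKC mN); elim: (N x - m)%N => [|d IH]; first by rewrite addn0.
  by rewrite addnS gS (le_trans IH)// lerDl.
elim: k => [_|k IH km]; first by rewrite (le_trans ler01).
have [_ _ _ h1] := hP k.
rewrite gS -natr1 lerD ?IH 1?ltnW// h1// => /le; apply: contra_not nKx; exact.
Qed.

End proper_time.

Section flow_functions.
Context {R : realType} {X : topologicalType} (psi : R -> X -> X).
Hypothesis flow_psi : continuous_flow psi.

(** Compactness of the segment makes the estimate uniform in [s]; this gives continuity of infima
    and suprema over times in a bounded interval. *)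
Lemma near_segment (F : R * X -> R) (x0 : X) (a b e : R) : continuous F ->
  0 < e -> \forall x \near x0, forall s, a <= s <= b ->
    `|F (s, x) - F (s, x0)| <= e.
Proof.
move=> cF e0.
have /compact_near_coveringP cK := @segment_compact R a b.
have := cK _ (nbhs x0) (fun x s => `|F (s, x) - F (s, x0)| <= e) _ _.
move=> /(_ _)/= h; have : \forall x \near x0,
    `[a, b]%classic `<=` (fun s => `|F (s, x) - F (s, x0)| <= e).
  apply: h => s _.
  have e2 : 0 < e / 2 by rewrite divr_gt0.
  have [[P Q] /= [nP nQ] PQ] := near_dist (s, x0) cF e2.
  exists (P, Q) => //= -[s' x] /= [Ps Qx].
  have /= := PQ (s', x) (conj Ps Qx).
  have /= := PQ (s', x0) (conj Ps (nbhs_singleton nQ)).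
  by rewrite !ler_norml => /andP[? ?] /andP[? ?]; apply/andP; split; lra.
by apply: filterS => x h1 s sab; apply: h1; rewrite /= in_itv.
Qed.

Lemma continuous_along (F : X -> R) (u : R * X -> R) :
  continuous F -> continuous u -> continuous (fun p => F (psi (u p) p.2)).
Proof.
have [cpsi _ _] := flow_psi.
move=> cF cu p.
have c1 : continuous (fun p : R * X => (u p, p.2)).
  by apply: continuous_pair => // q; exact: cvg_snd.
have c2 : continuous ((fun p : R * X => psi p.1 p.2) \o (fun p => (u p, p.2))).
  by move=> q; apply: continuous_comp; [exact: c1|exact: cpsi].
by have := continuous_comp (c2 p) (cF _).
Qed.

Definition proper_height (T : X -> R) :=
  forall a, exists2 K, compact K & forall x, T x <= a -> K x.

Hypothesis hausX : hausdorff_space X.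
Hypothesis lcX : locally_compact [set: X].
Hypothesis scX : sigma_compact X.

Lemma escape_time : exists T : X -> R,
  [/\ continuous T, forall x, 1 <= T x, proper_height T
    & forall t x, T (psi t x) <= T x + `|t|].
Proof.
have [f [cf f1 pf]] := @proper_function R X hausX lcX scX.
have [cpsi psi0 psiD] := flow_psi.
pose S x := [set f (psi s x) + `|s| | s in [set: R]].
have lbS x : lbound (S x) 1.
  by move=> _ [s _ <-]; have := f1 (psi s x); have := normr_ge0 s; lra.
have hS x : has_inf (S x).
  by split; [exists (f (psi 0 x) + `|0 : R|), 0|exists 1; exact: lbS].
pose T x := inf (S x).
have Tle s x : T x <= f (psi s x) + `|s|.
  by apply: ge_inf; [exists 1; exact: lbS|exists s].
have Tatt e x : 0 < e -> exists s, f (psi s x) + `|s| < T x + e.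
  by move=> /inf_adherent /(_ (hS x)) [_ [s _ <-] ?]; exists s.
have T1 x : 1 <= T x by apply: lb_le_inf (lbS x); exact: (hS x).1.
exists T; split=> //.
(* Near [x] the infimum is at most [f x + 1], so times attaining it up to 1 are bounded by [M], and
   only the segment from [- M] to [M] matters. *)
- apply: continuous_realP => x e e0; pose M := f x + 2.
  have cF : continuous (fun p : R * X => f (psi p.1 p.2) + `|p.1|).
    move=> p; apply: cvgD.
      by apply: (continuous_along (u := fst)) => // q; exact: cvg_fst.
    by apply: cvg_norm; exact: cvg_fst.
  have e2 : 0 < e / 2 by rewrite divr_gt0.
  have := near_segment x (- M) M cF e2.
  have := near_dist x cf ltr01; apply: filterS2 => y; rewrite ler_norml.
  move=> /andP[fy1 fy2] /= FM.
  have Tf z : T z <= f z by have := Tle 0 z; rewrite psi0 normr0 addr0.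
  have d0 : 0 < Num.min (e / 2) 1 by rewrite lt_min e2 ltr01.
  have dm : Num.min (e / 2) 1 <= e / 2 by rewrite ge_min lexx.
  have dm1 : Num.min (e / 2) 1 <= 1 by rewrite ge_min lexx orbT.
  have [s sx] := Tatt _ x d0; have [r ry] := Tatt _ y d0.
  have sM : - M <= s <= M.
    rewrite -ler_norml /M; have := f1 (psi s x); have := Tf x; lra.
  have rM : - M <= r <= M.
    rewrite -ler_norml /M; have := f1 (psi r y); have := Tf y; lra.
  have := FM _ sM; have := FM _ rM; rewrite !ler_norml => /andP[? ?] /andP[? ?].
  by have := Tle s y; have := Tle r x => ? ?; apply/andP; split; lra.
(* If [T x <= a], a nearly optimal time [s] is at most [a + 1] in size and leads into [K]; flowing
   back by [- s], [x] lies in the image of a compact product. *)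
- move=> a; have [K cK fK] := pf (a + 1).
  exists ((fun p : R * X => psi p.1 p.2) @` (`[- (a + 1), a + 1] `*` K)).
    apply: continuous_compact; first exact: continuous_subspaceT.
    by apply: compact_setX => //; exact: segment_compact.
  move=> x Tx; have [s sx] := Tatt _ x ltr01.
  exists (- s, psi s x) => /=; last by rewrite psiD addNr psi0.
  split=> /=.
    rewrite in_itv /= -ler_norml normrN.
    by have := f1 (psi s x); lra.
  by apply: fK; have := normr_ge0 s; lra.
(* A time [s] nearly optimal for [x] is tested as [s - t] at [psi t x]. *)
- move=> t x; apply/ler_addgt0Pr => e e0; have [s sx] := Tatt _ x e0.
  have := Tle (s - t) (psi t x); rewrite psiD subrK => h.
  by have := ler_normB s t; lra.
Qed.

(** * Slowing Lyapunov functions down near infinity *)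

Variable T : X -> R.
Hypothesis cT : continuous T.
Hypothesis T1 : forall x, 1 <= T x.
Hypothesis T_lip : forall t x, T (psi t x) <= T x + `|t|.

Definition flow_monotone (L : X -> R) :=
  forall x t, 0 <= t -> L x <= L (psi t x).

(* Looking ahead along the orbit costs [k] per fraction of the escape time, so
   that the result is Lyapunov, exceeds [L] little for large [k], and varies
   along orbits with speed at most [2 k / T]. *)
Definition slowed (L : X -> R) (k : nat) (x : X) : R :=
  sup [set L (psi (s * T x) x) - k%:R * s | s in `[0, 1]%classic].

Section slowed_theory.
Variable L : X -> R.
Hypothesis cL : continuous L.
Hypothesis bL : forall x, 0 <= L x <= 1.
Hypothesis mL : flow_monotone L.
Variable k : nat.

Let S x := [set L (psi (s * T x) x) - k%:R * s | s in `[0, 1]%classic].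

Let supS x : has_sup (S x).
Proof.
split.
  exists (L (psi (0 * T x) x) - k%:R * 0), 0 => //=.
  by rewrite in_itv /= lexx ler01.
exists 1 => _ [s /= + <-]; rewrite in_itv /= => /andP[s0 s1].
have /andP[_] := bL (psi (s * T x) x).
have : 0 <= k%:R * s by rewrite mulr_ge0.
lra.
Qed.

Lemma slowed_ub s x : 0 <= s <= 1 -> L (psi (s * T x) x) - k%:R * s <= slowed L k x.
Proof.
move=> s01; apply: sup_upper_bound; first exact: supS.
by exists s => //=; rewrite in_itv.
Qed.

Lemma slowed_le x a : (forall s, 0 <= s <= 1 -> L (psi (s * T x) x) - k%:R * s <= a) ->
  slowed L k x <= a.
Proof.
move=> h; apply: ge_sup; first exact: (supS x).1.
by move=> _ [s /= s01 <-]; apply: h; move: s01; rewrite in_itv.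
Qed.

Lemma le_slowed x : L x <= slowed L k x.
Proof.
have [_ psi0 _] := flow_psi.
by have := @slowed_ub 0 x; rewrite mul0r mulr0 subr0 psi0 lexx ler01; apply.
Qed.

Lemma slowed_bounds x : 0 <= slowed L k x <= 1.
Proof.
apply/andP; split; first by apply: le_trans (le_slowed x); case/andP: (bL x).
apply: slowed_le => s /andP[s0 s1]; have /andP[_] := bL (psi (s * T x) x).
by have : 0 <= k%:R * s by [rewrite mulr_ge0]; lra.
Qed.

(** For the same [s], hence the same cost, looking ahead from [psi t x] reaches at least as far
    along the orbit as from [x]: the look-ahead time shrinks by at most [s * t], while the start is
    ahead by [t]. *)
Lemma slowed_monotone : flow_monotone (slowed L k).
Proof.
have [_ psi0 psiD] := flow_psi.
move=> x t t0; apply: slowed_le => s s01; apply: le_trans (slowed_ub _ s01).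
rewrite lerD2r psiD; have /andP[s0 s1] := s01.
rewrite -[s * T (psi t x) + t](addrNK (s * T x)) -psiD; apply: mL.
have := T_lip (- t) (psi t x); rewrite psiD addNr psi0 normrN ger0_norm// => h.
have : s * (T x - T (psi t x)) <= s * t by rewrite ler_wpM2l//; lra.
have : s * t <= 1 * t by rewrite ler_wpM2r.
by rewrite mulrBr; lra.
Qed.

(** Looking ahead by [s] from [psi t x] reaches at most the time [s * T x + 2 * t] after [x], which
    is covered from [x] by [r = s + 2 * t / T x]; the excess cost is the claimed increment. *)
Lemma slowed_speed x t : (0 < k)%N -> 0 <= t ->
  slowed L k (psi t x) <= slowed L k x + 2 * k%:R * t / T x.
Proof.
have [_ psi0 psiD] := flow_psi.
move=> k0 t0; have Tx0 : 0 < T x by apply: lt_le_trans (T1 x).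
have k1 : 1 <= k%:R :> R by rewrite ler1n.
apply: slowed_le => s /andP[s0 s1].
set r := s + 2 * t / T x.
have tT : 0 <= t / T x by rewrite divr_ge0// ltW.
have kr : k%:R * r = k%:R * s + 2 * k%:R * t / T x by rewrite /r; ring.
have sr : s <= r by rewrite /r -mulrA; lra.
have [r1|r1] := leP r 1.
  have : L (psi (s * T (psi t x)) (psi t x)) <= L (psi (r * T x) x).
    rewrite psiD -[r * T x](subrK (s * T (psi t x) + t)) -(psiD (_ - _)).
    apply: mL.
    have -> : r * T x = s * T x + 2 * t.
      by rewrite /r mulrDl divfK// gt_eqF.
    have := T_lip t x; rewrite ger0_norm// => h.
    have : s * T (psi t x) <= s * (T x + t) by rewrite ler_wpM2l.
    have : s * t <= 1 * t by rewrite ler_wpM2r.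
    by rewrite mulrDr; lra.
  have := @slowed_ub r x; rewrite r1 (le_trans s0 sr) => /(_ isT).
  by rewrite kr; lra.
(* Here [r] is beyond the allowed range, but then the cost [k * r] is at least 1 and so exceeds any
   value of [L]. *)
have /andP[? _] := slowed_bounds x.
have /andP[_ ?] := bL (psi (s * T (psi t x)) (psi t x)).
have : 1 <= k%:R * r by apply: mulr_ege1 => //; exact: ltW.
by rewrite kr; lra.
Qed.

Lemma continuous_slowed : continuous (slowed L k).
Proof.
have cF : continuous (fun p : R * X => L (psi (p.1 * T p.2) p.2) - k%:R * p.1).
  move=> p; apply: cvgB.
    apply: (continuous_along (u := fun p => p.1 * T p.2)) => // q.
    apply: cvgM; first exact: cvg_fst.
    by apply: (cvg_comp _ _ (@cvg_snd _ _ _ _ _)); exact: cT.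
  by apply: cvgM; [exact: cvg_cst|exact: cvg_fst].
apply: continuous_realP => x e e0.
have := near_segment x 0 1 cF e0; apply: filterS => y h.
rewrite ler_norml; apply/andP; split.
  suff : slowed L k x <= slowed L k y + e by lra.
  apply: slowed_le => s s01; have := slowed_ub y s01; have := h _ s01.
  by rewrite /= ler_norml => /andP[]; lra.
suff : slowed L k y <= slowed L k x + e by lra.
apply: slowed_le => s s01; have := slowed_ub x s01; have := h _ s01.
by rewrite /= ler_norml => /andP[]; lra.
Qed.

End slowed_theory.

(** Slowing does not lower the value at [x]. At [y], a look-ahead below [d] keeps [L] under the
    midpoint [c], and one of [d] or more costs at least 1 once [k.+1] exceeds [d^-1]. *)
Lemma slowed_separates (L : X -> R) x y : continuous L ->
  (forall x, 0 <= L x <= 1) -> flow_monotone L -> L y < L x ->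
  exists k, slowed L k.+1 y < slowed L k.+1 x.
Proof.
have [_ psi0 psiD] := flow_psi.
move=> cL bL mL yx; pose c := (L x + L y) / 2.
have cg : continuous (fun s : R => L (psi (s * T y) y)).
  move=> s; have h : continuous (fun s : R => (s, y)).
    by apply: continuous_pair => u; [exact: cvg_id|exact: cvg_cst].
  have c1 : continuous (fun p : R * X => L (psi (p.1 * T y) p.2)).
    apply: (continuous_along (u := fun p => p.1 * T y)) => // q.
    by apply: cvgM; [exact: cvg_fst|exact: cvg_cst].
  by have := continuous_comp (h s) (c1 _).
have d0 : 0 < (L x - L y) / 2 by rewrite divr_gt0// subr_gt0.
have [d /= dpos dP] := near_dist (0 : R) cg d0.
pose k := Num.bound (d^-1).
have kd : d^-1 < k.+1%:R.
  apply: (@lt_trans _ _ k%:R); last by rewrite ltr_nat.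
  by apply: archi_boundP; rewrite invr_ge0 ltW.
exists k; apply: (@le_lt_trans _ _ c); last first.
  by apply: (@lt_le_trans _ _ (L x)); [rewrite /c; lra|exact: le_slowed].
apply: slowed_le => // s /andP[s0 s1].
have [sd|sd] := ltP s d.
  have := dP s; rewrite /= sub0r normrN ger0_norm// => /(_ sd).
  rewrite mul0r psi0 ler_norml => /andP[_].
  have : 0 <= k.+1%:R * s by rewrite mulr_ge0.
  by rewrite /c; lra.
have : 1 <= k.+1%:R * s.
  by rewrite -[leLHS](mulVf (lt0r_neq0 dpos)) ler_pM ?invr_ge0// ltW.
have /andP[_] := bL (psi (s * T y) y); have /andP[] := bL y.
by rewrite /c; have := yx; lra.
Qed.

End flow_functions.

(** * The Stone-Weierstrass theorem *)

Section stone_weierstrass.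
Context {R : realType} {Y : topologicalType} (A : set (Y -> R)).
Hypothesis cptY : compact [set: Y].
Hypothesis A_cont : forall u, A u -> continuous u.
Hypothesis A_cst : forall c, A (fun=> c).
Hypothesis A_add : forall u v, A u -> A v -> A (u \+ v).
Hypothesis A_mul : forall u v, A u -> A v -> A (u \* v).
Hypothesis A_lim : forall v, continuous v ->
  (forall e, 0 < e -> exists2 u, A u & forall y, `|u y - v y| <= e) -> A v.
Hypothesis A_sep : forall x y, x <> y -> exists2 u, A u & u x <> u y.

Let A_scale c u : A u -> A (fun y => c * u y).
Proof. by move=> Au; exact: (A_mul (A_cst c) Au). Qed.

Lemma compact_bounded (u : Y -> R) : continuous u ->
  exists2 M, 0 < M & forall y, `|u y| <= M.
Proof.
move=> cu; have /compact_near_coveringP cY := cptY.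
have [y _|M [Mr MP]] := cY _ (+oo)%R (fun M y => `|u y| <= M) _; last first.
  exists (Num.max M 1 + 1); first by rewrite ltr_wpDl// le_max ler01 orbT.
  by move=> y; apply: MP => //; rewrite ltr_pwDr// le_max lexx.
have := near_dist y cu ltr01 => h.
exists ([set z | `|u z - u y| <= 1], [set M | `|u y| + 1 <= M]).
  by split=> //=; exact: nbhs_pinfty_ge.
move=> [z M] /= [zy yM]; apply: le_trans yM.
by have := ler_normD (u z - u y) (u y); rewrite subrK; lra.
Qed.

(* [q n] increases to [`|u|]: Newton-like iteration, with error at most
   [`|u| (1 - `|u| / 2) ^+ n]. *)
Let A_abs_unit u : A u -> (forall y, `|u y| <= 1) -> A (fun y => `|u y|).
Proof.
move=> Au u1.
pose q := fix q n : Y -> R :=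
  if n is m.+1 then (fun y => q m y + 2^-1 * (u y * u y + -1 * (q m y * q m y)))
  else (fun=> 0).
have Aq n : A (q n).
  elim: n => [|n IH]; first exact: A_cst.
  apply: (A_add IH); apply: A_scale; apply: A_add; first exact: A_mul.
  by apply: A_scale; exact: A_mul.
have qP n y : 0 <= q n y /\
    0 <= `|u y| - q n y <= `|u y| * (1 - `|u y| / 2) ^+ n.
  set w := `|u y|; have w0 : 0 <= w by exact: normr_ge0.
  have w1 : w <= 1 by exact: u1.
  have uw : u y * u y = w * w by rewrite -normrM ger0_norm// -expr2 sqr_ge0.
  elim: n => [|n [q0 /andP[q1 q2]]] /=; first by rewrite expr0 mulr1 subr0 lexx w0 lexx.
  rewrite uw; set z := q n y in q0 q1 q2 *.
  have zw : z <= w by lra.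
  (* Each iteration multiplies the error by a factor between 0 and [1 - w / 2]. *)
  have E : w - (z + 2^-1 * (w * w + -1 * (z * z))) = (w - z) * (1 - (w + z) / 2).
    by field.
  split.
    have : z * z <= w * w by apply: ler_pM.
    by lra.
  rewrite E exprSr mulrA; apply/andP; split; first by apply: mulr_ge0 => //; lra.
  by apply: ler_pM => //; lra.
apply: A_lim => [y|e e0]; first by apply: cvg_norm; exact: A_cont.
(* Where [|u|] is at most [d] the error is at most [|u|], hence at most [e]; elsewhere the power is
   at most [(1 - d / 2) ^+ N], which is less than [d]. *)
pose d := Num.min e 1.
have d0 : 0 < d by rewrite lt_min e0 ltr01.
have d1 : d <= 1 by rewrite ge_min lexx orbT.
have de : d <= e by rewrite ge_min lexx.
have h : (1 - d / 2) ^+ n @[n --> \oo] --> (0 : R).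
  by apply: cvg_expr; rewrite ltr_norml; apply/andP; split; lra.
have /cvgrPdist_lt/(_ d d0)[N _ /(_ N (leqnn N))] := h.
rewrite /= sub0r normrN ger0_norm ?exprn_ge0//; last by lra.
move=> hN; exists (q N) => // y.
have [q0 /andP[q1 q2]] := qP N y.
rewrite distrC ger0_norm//; apply: le_trans q2 _.
have w0 : 0 <= `|u y| by exact: normr_ge0.
have w1 : `|u y| <= 1 by exact: u1.
have b0 : 0 <= (1 - `|u y| / 2) ^+ N by rewrite exprn_ge0//; lra.
have [wd|wd] := leP `|u y| d.
  apply: le_trans de; rewrite -[leRHS]mulr1 ler_pM// exprn_ile1//; lra.
apply: le_trans de; rewrite -[leRHS]mul1r ler_pM//.
apply: le_trans (ltW hN); rewrite lerXn2r// ?nnegrE; lra.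
Qed.

Let A_abs u : A u -> A (fun y => `|u y|).
Proof.
move=> Au; have [M M0 uM] := compact_bounded (A_cont Au).
rewrite (_ : (fun y => _) = (fun y => M * `|M^-1 * u y|)).
  apply: A_scale; apply: A_abs_unit; first exact: A_scale.
  move=> y; rewrite normrM gtr0_norm ?invr_gt0// mulrC ler_pdivrMr// mul1r.
  exact: uM.
apply/funext => y; rewrite normrM (gtr0_norm (x := M^-1)) ?invr_gt0//.
by rewrite mulrA divff ?mul1r// gt_eqF.
Qed.

Let A_max u v : A u -> A v -> A (fun y => Num.max (u y) (v y)).
Proof.
move=> Au Av; rewrite (_ : (fun y => _) =
    (fun y => 2^-1 * (u y + v y + `|u y + -1 * v y|))).
  apply: A_scale; apply: A_add; first exact: A_add.
  by apply: A_abs; apply: A_add => //; exact: A_scale.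
apply/funext => y; rewrite mulN1r maxr_absE; by field.
Qed.

Let A_min u v : A u -> A v -> A (fun y => Num.min (u y) (v y)).
Proof.
move=> Au Av; rewrite (_ : (fun y => _) =
    (fun y => 2^-1 * (u y + v y + -1 * `|u y + -1 * v y|))).
  apply: A_scale; apply: A_add; first exact: A_add.
  by apply: A_scale; apply: A_abs; apply: A_add => //; exact: A_scale.
apply/funext => y; rewrite !mulN1r minr_absE; by field.
Qed.

Let interpolation (v : Y -> R) x y : exists u, [/\ A u, u x = v x & u y = v y].
Proof.
have [->|xy] := pselect (x = y); first by exists (fun=> v y).
have [s As sxy] := A_sep xy.
exists (fun z => v x + (v y - v x) / (s y - s x) * (s z + - s x)).
have d0 : s y - s x != 0 by rewrite subr_eq0; apply/eqP/nesym.
split; last 2 first.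
- by rewrite subrr mulr0 addr0.
- by rewrite divfK// addrC subrK.
apply: A_add => //; apply: A_scale; apply: A_add => //.
Qed.

Lemma stone_weierstrass v : continuous v -> A v.
Proof.
move=> cv; have /compact_near_coveringP cY := cptY.
(* Functions of [A] agreeing with [v] at [x] are directed upwards by maxima; compactness for the
   filter of their upper bounds replaces the maximum of a finite subcover. *)
have above x e : 0 < e -> exists u, [/\ A u, u x = v x & forall y, v y - e <= u y].
  move=> e0; pose D := [set u | A u /\ u x = v x].
  pose F := filter_from D (fun u => [set w | forall y, u y <= w y]).
  have FF : Filter F.
    apply: filter_from_filter; first by exists (fun=> v x).
    move=> u w [Au ux] [Aw wx]; exists (fun y => Num.max (u y) (w y)).
      by split; [exact: A_max|rewrite ux wx maxxx].
    by move=> z /= uwz; split=> y; apply: le_trans (uwz y); rewrite le_max lexx ?orbT.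
  have [y _|u [Au ux] uP] := cY _ F (fun w y => v y - e <= w y) FF; last first.
    by exists u; split=> // y; apply: (uP u).
  have [u [Au ux uy]] := interpolation v x y.
  have e2 : 0 < e / 2 by rewrite divr_gt0.
  have h1 := near_dist y cv e2; have h2 := near_dist y (A_cont Au) e2.
  exists ([set z | `|v z - v y| <= e / 2 /\ `|u z - u y| <= e / 2],
          [set w | forall y, u y <= w y]).
    by split; [exact: filterI|exists u].
  move=> [z w] /= [[vz uz] uw]; have := uw z; move: vz uz.
  by rewrite !ler_norml uy => /andP[? ?] /andP[? ?] ?; lra.
apply: A_lim => // e e0.
have [[x0 _]|Y0] := pselect (exists x0 : Y, True); last first.
  by exists (fun=> 0) => // y; exfalso; apply: Y0; exists y.
(* The dual argument: these functions are directed downwards by minima, and at each point some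
   member agrees with [v]. *)
pose D := [set u | A u /\ forall y, v y - e <= u y].
pose F := filter_from D (fun u => [set w | forall y, w y <= u y]).
have FF : Filter F.
  apply: filter_from_filter.
    by have [u [Au _ uv]] := above x0 e e0; exists u.
  move=> u w [Au uv] [Aw wv]; exists (fun y => Num.min (u y) (w y)).
    by split; [exact: A_min|move=> y; rewrite le_min uv wv].
  by move=> z /= uwz; split=> y; apply: le_trans (uwz y) _; rewrite ge_min lexx ?orbT.
have [y _|u [Au uv] uP] := cY _ F (fun w y => w y <= v y + e) FF; last first.
  exists u => // y; have := uP u (fun y => lexx _) y I; have := uv y.
  by rewrite ler_norml => ? ?; apply/andP; split; lra.
have [u [Au uy uv]] := above y e e0.
have e2 : 0 < e / 2 by rewrite divr_gt0.
have h1 := near_dist y cv e2; have h2 := near_dist y (A_cont Au) e2.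
exists ([set z | `|v z - v y| <= e / 2 /\ `|u z - u y| <= e / 2],
        [set w | forall y, w y <= u y]).
  by split; [exact: filterI|exists u].
move=> [z w] /= [[vz uz] uw]; have := uw z; move: vz uz.
by rewrite !ler_norml uy => /andP[? ?] /andP[? ?] ?; lra.
Qed.

End stone_weierstrass.

(** * The compactification defined by a family of functions *)

Section uniform_closure.
Context {R : realType} {X : topologicalType}.
Implicit Types (u v : X -> R).

Lemma bounded_funP u : bounded_fun u <-> exists M, forall x, `|u x| <= M.
Proof.
split=> [[M [_ /(_ (M + 1))]]|[M uM]].
  by rewrite ltrDl ltr01 => /(_ isT) h; exists (M + 1) => x; exact: h.
by exists M; split; [exact: num_real|move=> z Mz x _; exact: le_trans (ltW Mz)].
Qed.

Lemma uniform_closureP (A : set (X -> R)) v :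
  closure (A : set {uniform X -> R}) v <->
  forall e, 0 < e -> exists2 u, A u & forall x, `|u x - v x| <= e.
Proof.
split=> [clA e e0|h B /uniform_nbhs[E [/= entE EB]]].
  have nB : nbhs (v : {uniform X -> R}) [set h | forall x, `|h x - v x| <= e].
    apply/uniform_nbhs; exists [set p | ball p.1 e p.2]; split.
      exact: (entourage_ball _ (PosNum e0)).
    by move=> h /= hE x; have := hE x I; rewrite /ball /= distrC => /ltW.
  by have [u [Au ue]] := clA _ nB; exists u.
move: entE; rewrite -entourage_ballE => -[e /= e0 eE].
have [|u Au ue] := h (e / 2); first by rewrite divr_gt0.
exists u; split=> //; apply: EB => x _; apply: eE.
rewrite /ball /= distrC; apply: le_lt_trans (ue x) _.
by rewrite ltr_pdivrMr// mulr_natr mulr2n ltrDl.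
Qed.

End uniform_closure.

(** The first two clauses map [X] continuously into a product of segments, the third makes the map
    injective, and the last makes the image open in its closure. *)
Definition coordinate_family (R : realType) (X : topologicalType)
    (W : set (X -> R)) :=
  [/\ forall w, W w -> continuous w,
      forall w, W w -> exists M, forall x, `|w x| <= M,
      forall x y, x <> y -> exists2 w, W w & w x <> w y
    & forall x, exists w, [/\ W w, 0 < w x &
        exists2 K, compact K & forall z, 0 < w z -> K z]].

Section compactification.
Context {R : realType} {X : topologicalType}.
Hypothesis hausX : hausdorff_space X.
Variable W : set (X -> R).
Hypothesis hW : coordinate_family W.

Let W_cont w : W w -> continuous w.
Proof. by have [h _ _ _] := hW; exact: h. Qed.

Let W_bounded w : W w -> exists M, forall x, `|w x| <= M.
Proof. by have [_ h _ _] := hW; exact: h. Qed.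

Let W_sep x y : x <> y -> exists2 w, W w & w x <> w y.
Proof. by have [_ _ h _] := hW; exact: h. Qed.

Let W_cpt x : exists w, [/\ W w, 0 < w x &
  exists2 K, compact K & forall z, 0 < w z -> K z].
Proof. by have [_ _ _ h] := hW; exact: h. Qed.

Definition coordinate_index := {classic set_type W}.

Definition coordinate_space := prod_topology (fun _ : coordinate_index => R).

Definition coordinates (x : X) : coordinate_space := fun i => set_val i x.

Definition compactification : topologicalType :=
  set_type (closure (range coordinates)).

Definition embedding (x : X) : compactification :=
  exist _ (coordinates x)
    (mem_set (subset_closure (ex_intro2 _ _ x I (erefl (coordinates x))))).

Definition coord (i : coordinate_index) (y : compactification) : R :=
  (set_val y : coordinate_space) i.

Lemma coord_embedding i x : coord i (embedding x) = set_val i x.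
Proof. by []. Qed.

Lemma continuous_coord i : continuous (coord i).
Proof.
move=> y.
have c1 : continuous (set_val : compactification -> coordinate_space).
  exact: initial_continuous.
exact: (continuous_comp (c1 y) (@proj_continuous _ (fun _ => R) i _)).
Qed.

Lemma cvg_coordinates (S : topologicalType) (f : S -> compactification) (s : S)
    (y : compactification) :
  (forall i, coord i (f t) @[t --> s] --> coord i y) ->
  f t @[t --> s] --> y.
Proof.
move=> cf.
have c1 : (set_val (f t) : coordinate_space) @[t --> s] -->
      (set_val y : coordinate_space).
  apply/cvg_sup => i U [V [[Q oQ <-]]] Qy VU.
  apply: (filterS VU); apply: (cf i); exact: open_nbhs_nbhs.
move=> U [V [[Q oQ <-]]] Qy VU; apply: (filterS VU).
by apply: c1; exact: open_nbhs_nbhs.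
Qed.

Lemma coord_inj y z : (forall i, coord i y = coord i z) -> y = z.
Proof. by move=> yz; apply: val_inj; apply/funext => i; exact: yz. Qed.

Lemma compactification_hausdorff : hausdorff_space compactification.
Proof.
move=> y z yz; apply: coord_inj => i; apply/eqP/negPn/negP => /eqP ne.
have e0 : 0 < `|coord i y - coord i z| / 3.
  by rewrite divr_gt0// normr_gt0 subr_eq0; apply/eqP.
have ny := near_dist y (@continuous_coord i) e0.
have nz := near_dist z (@continuous_coord i) e0.
have [u [/= uy uz]] := yz _ _ ny nz.
have := ler_distD (coord i u) (coord i y) (coord i z).
by rewrite (distrC _ (coord i u)); lra.
Qed.

Lemma compactification_compact : compact [set: compactification].
Proof.
have hM (i : coordinate_index) : exists M, forall x, `|set_val i x| <= M.
  by apply: W_bounded; exact: set_valP.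
have [M MP] := choice hM.
pose box : set coordinate_space := [set p | forall i, `[- M i, M i]%classic (p i)].
have cbox : compact box.
  apply: (@tychonoff coordinate_index (fun=> R)
    (fun i => `[- M i, M i]%classic)) => i.
  exact: segment_compact.
have clbox : closed box.
  rewrite (_ : box = \bigcap_i ((fun p : coordinate_space => p i) @^-1` `[- M i, M i]%classic)).
    apply: closed_bigI => i _; apply: preimage_closed.
      by move=> p _; exact: (@proj_continuous _ (fun _ => R) i).
    exact: interval_closed.
  by apply/seteqP; split=> [p h i _|p h i]; [exact: h|exact: (h i I)].
have cC : compact (closure (range coordinates)).
  apply: (subclosed_compact _ cbox); first exact: closed_closure.
  rewrite closureE => p; apply; split=> // _ [x _ <-] i /=.
  by rewrite in_itv /= -ler_norml; exact: MP.
(* The filter is pushed forward to the product, where it clusters at a point of the compact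
   closure. *)
move=> F PF _.
have PG : ProperFilter ((set_val : compactification -> coordinate_space) @ F).
  exact: fmap_proper_filter.
have [|p [Cp clp]] := cC _ PG.
  by rewrite /fmap /=; apply: filterS filterT => y _; exact: set_valP.
exists (exist _ p (mem_set Cp)); split=> // A B FA [V [[Q oQ <-]]] /= Qp VB.
have GA : F (set_val @^-1` (set_val @` A)).
  by apply: filterS FA => y Ay; exists y.
have [q [[y Ay <-] Qq]] := clp _ Q GA (open_nbhs_nbhs (conj oQ Qp)).
by exists y; split=> //; exact: VB.
Qed.

Lemma dense_embedding : dense (range embedding).
Proof.
move=> Q [y Qy] [Q' oQ' QE]; move: Qy; rewrite -QE => Q'y.
have : closure (range coordinates) (set_val y) by exact: set_valP.
move=> /(_ Q' (open_nbhs_nbhs (conj oQ' Q'y))) [_ [[x _ <-] Qx]].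
by exists (embedding x); split=> //; exists x.
Qed.

Lemma embedding_inj : injective embedding.
Proof.
move=> x y xy; apply: contrapT => /W_sep[w Ww]; apply.
have := congr1 (coord (exist _ w (mem_set Ww))) xy.
by rewrite !coord_embedding.
Qed.

Lemma continuous_embedding : continuous embedding.
Proof.
move=> x; apply: cvg_coordinates => i.
by apply: W_cont; exact: set_valP.
Qed.

Lemma closed_embedding_compact K : compact K -> closed (embedding @` K).
Proof.
move=> cK; apply: compact_closed; first exact: compactification_hausdorff.
apply: continuous_compact => //; apply: continuous_subspaceT.
exact: continuous_embedding.
Qed.

(** Take the points where a coordinate [w] positive only inside a compact [K] is positive, off the
    closed image of [K] minus [U]. They lie in the image of [K]: otherwise density would give a
    point off [K] with [w] positive. *)
Lemma open_embedding (U : set X) : open U -> open (embedding @` U).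
Proof.
move=> oU; rewrite openE => _ [x Ux <-]; rewrite /interior.
have [w [Ww wx [K cK wK]]] := W_cpt x.
pose i : coordinate_index := exist _ w (mem_set Ww).
have cKU : compact (K `\` U).
  apply: (subclosed_compact _ cK) => [|z []//].
  by apply: closedI; [exact: compact_closed|exact: open_closedC].
have opos : open [set y | 0 < coord i y].
  apply: (@open_comp _ _ (coord i) [set t | 0 < t]); last exact: open_gt.
  by move=> y _; exact: continuous_coord.
have n1 : nbhs (embedding x) [set y | 0 < coord i y] by exact: open_nbhs_nbhs.
have n2 : nbhs (embedding x) (~` (embedding @` (K `\` U))).
  apply: open_nbhs_nbhs; split.
    by apply: closed_openC; exact: closed_embedding_compact.
  by move=> [z [Kz nUz] /embedding_inj zx]; apply: nUz; rewrite zx.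
apply: filterS2 n1 n2 => y /= ypos yKU.
have [[z Kz zy]|nKy] := pselect ((embedding @` K) y).
  exists z => //; apply: contrapT => nUz; apply: yKU; by exists z.
have [||z [[ez nKz] [t _ tz]]] :=
    @dense_embedding ([set y | 0 < coord i y] `&` ~` (embedding @` K)).
- by exists y.
- apply: openI => //; apply: closed_openC; exact: closed_embedding_compact.
- move: ez nKz; rewrite -tz /= => wt nKt; exfalso; apply: nKt; exists t => //.
  exact: wK.
Qed.

Lemma embedding_proper_compactification : proper_compactification embedding.
Proof.
split.
- exact: compactification_hausdorff.
- exact: compactification_compact.
- exact: embedding_inj.
- move=> U; split=> [oU|[V oV <-]].
    exists (embedding @` U); first exact: open_embedding.
    by apply/seteqP; split=> [x [z Uz /embedding_inj <-]|x Ux]//; exists x.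
  by apply: open_comp oV => x _; exact: continuous_embedding.
- exact: dense_embedding.
Qed.

End compactification.

(** * Extension of the flow by the identity at infinity *)

Section compactification_flow.
Context {R : realType} {X : topologicalType}.
Hypothesis hausX : hausdorff_space X.
Variable W : set (X -> R).
Hypothesis hW : coordinate_family W.
Variable psi : R -> X -> X.
Hypothesis flow_psi : continuous_flow psi.
Hypothesis slow_W : forall w tau e, W w -> 0 < e ->
  exists2 K, compact K & forall x s, ~ K x -> `|s| <= tau ->
    `|w (psi s x) - w x| <= e.

Local Notation e := (@embedding R X W).

Definition extended_flow (t : R) (y : compactification W) : compactification W :=
  if pselect (exists x, e x = y) is left h then e (psi t (projT1 (cid h)))
  else y.

Lemma extended_flow_embedding t x : extended_flow t (e x) = e (psi t x).
Proof.
rewrite /extended_flow; case: pselect => [h|]; last by case; exists x.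
by congr (e (psi t _)); apply: (embedding_inj hW); exact: (projT2 (cid h)).
Qed.

Lemma extended_flow_fixed t y : ~ range e y -> extended_flow t y = y.
Proof.
rewrite /extended_flow; case: pselect => // -[x xy] h.
by exfalso; apply: h; exists x.
Qed.

Lemma extended_flow_flow : continuous_flow extended_flow.
Proof.
have [cpsi psi0 psiD] := flow_psi.
split=> [[t0 y0]|y|s t y]; last 2 first.
- have [[x _ <-]|ny] := pselect (range e y).
    by rewrite extended_flow_embedding psi0.
  by rewrite extended_flow_fixed.
- have [[x _ <-]|ny] := pselect (range e y).
    by rewrite !extended_flow_embedding psiD.
  by rewrite !extended_flow_fixed.
have [[x0 _ <-]|ny0] := pselect (range e y0).
  rewrite /continuous_at /= extended_flow_embedding => U nU.
  have cex : continuous (fun p : R * X => e (psi p.1 p.2)).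
    have ce : continuous e by exact: continuous_embedding.
    by move=> p; exact: (continuous_comp (cpsi p) (ce _)).
  have [[A B] /= [nA nB] AB] := cex (t0, x0) U nU.
  move: nB; rewrite nbhsE => -[B' [oB' B'x B'B]].
  exists (A, e @` B') => /=.
    split=> //; apply: open_nbhs_nbhs; split; last by exists x0.
    exact: open_embedding.
  move=> [t _] /= [At [x Bx <-]]; rewrite extended_flow_embedding.
  by apply: (AB (t, x)); split=> //; exact: B'B.
(* At a point at infinity, a neighbourhood off the image of [K] contains only fixed points and
   points [e x] with [x] off [K], whose coordinate moves by at most [eps / 2] during the times near
   [t0]. *)
rewrite /continuous_at /= extended_flow_fixed//.
apply: cvg_coordinates => i; apply/cvgrPdist_le => eps eps0.
have e2 : 0 < eps / 2 by rewrite divr_gt0.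
have Wi : W (set_val i) by exact: set_valP.
have [K cK slow] := slow_W (`|t0| + 1) Wi e2.
have n1 := near_dist y0 (@continuous_coord _ _ W i) e2.
have n2 : nbhs y0 (~` (e @` K)).
  apply: open_nbhs_nbhs; split.
    by apply: closed_openC; exact: closed_embedding_compact.
  by move=> [x _ xy]; apply: ny0; exists x.
have n3 : \forall t \near t0, `|t| <= `|t0| + 1.
  have := near_dist t0 (fun x => cvg_id (F := nbhs x)) ltr01.
  apply: filterS => t /= h; have := ler_normD (t - t0) t0.
  by rewrite subrK; lra.
exists ([set t | `|t| <= `|t0| + 1],
  [set y | `|coord i y - coord i y0| <= eps / 2] `&` ~` (e @` K)) => /=.
  by split=> //; exact: filterI.
move=> [t y] /= [tt [yy nKy]]; rewrite distrC.
have [[x _ xy]|ny] := pselect (range e y); last first.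
  by rewrite extended_flow_fixed//; lra.
move: yy; rewrite -xy extended_flow_embedding !coord_embedding.
have nKx : ~ K x by move=> Kx; apply: nKy; exists x.
have := slow x t nKx tt; rewrite !ler_norml => /andP[? ?] /andP[? ?].
by apply/andP; split; lra.
Qed.

End compactification_flow.

Lemma flow_homeomorphism (R : realType) (Y : topologicalType)
    (psi : R -> Y -> Y) t : continuous_flow psi -> homeomorphism (psi t).
Proof.
move=> [cpsi psi0 psiD].
have ct s : continuous (psi s).
  have h : continuous (fun y : Y => (s, y)).
    by apply: continuous_pair => y; [exact: cvg_cst|exact: cvg_id].
  by move=> y; exact: (continuous_comp (h y) (cpsi _)).
split=> //; exists (psi (- t)); split=> // y.
  by rewrite psiD addNr psi0.
by rewrite psiD subrr psi0.
Qed.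

Program Definition semiflow_of_flow (R : realType) (Y : topologicalType)
    (psi : R -> Y -> Y) (flow_psi : continuous_flow psi) : semiflow R Y :=
  @Semiflow R Y psi _ _ _.
Next Obligation.
by move=> R Y psi [cpsi _ _]; exact: continuous_subspaceT.
Qed.
Next Obligation. by move=> R Y psi [_ h _]. Qed.
Next Obligation. by move=> R Y psi [_ _ h] s t x _ _; exact: h. Qed.

(** * The algebra of functions extending to the compactification *)

Section compactification_algebra.
Context {R : realType} {X : topologicalType}.
Hypothesis hausX : hausdorff_space X.
Variable W : set (X -> R).
Hypothesis hW : coordinate_family W.

Local Notation e := (@embedding R X W).

Let cptY := compactification_compact hW.

Let near_range (f g : compactification W -> R) c : continuous f -> continuous g ->
  (forall x, f (e x) <= g (e x) + c) -> forall y, f y <= g y + c.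
Proof.
move=> cf cg fg y; apply/ler_addgt0Pr => d d0.
have d2 : 0 < d / 2 by rewrite divr_gt0.
have : nbhs y ([set z | `|f z - f y| <= d / 2] `&`
    [set z | `|g z - g y| <= d / 2]).
  apply: filterI; first exact: (near_dist y cf d2).
  exact: (near_dist y cg d2).
rewrite nbhsE => -[U [oU Uy] UU].
have [z [Uz [x _ xz]]] := @dense_embedding R X W U (ex_intro _ y Uy) oU.
have [/= h1 h2] := UU _ Uz; have := fg x; move: h1 h2; rewrite -xz !ler_norml.
by move=> /andP[? ?] /andP[? ?] ?; lra.
Qed.

Lemma extendable_closed_subalgebra :
  closed_subalgebra (extendable_functions e : set (X -> R)).
Proof.
have bc (v : compactification W -> R) : continuous v ->
    bounded_continuous (v \o e : X -> R).
  move=> cv; have ce : continuous e by exact: continuous_embedding.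
  split; first by move=> x; exact: (continuous_comp (ce x) (cv _)).
  apply/bounded_funP; have [M _ vM] := compact_bounded cptY cv.
  by exists M => x; exact: vM.
have ext (v : compactification W -> R) : continuous v ->
    extendable_functions e (v \o e : X -> R).
  by move=> cv; split; [exact: bc|exists v].
split.
- by move=> u [].
- by move=> c; apply: (ext (cst c)); exact: cst_continuous.
- move=> _ _ [_ [u cu <-]] [_ [v cv <-]].
  have cuv : continuous (u \+ v) by move=> y; exact: (cvgD (cu y) (cv y)).
  exact: ext cuv.
- move=> _ _ [_ [u cu <-]] [_ [v cv <-]].
  have cuv : continuous (u \* v) by move=> y; exact: (cvgM (cu y) (cv y)).
  exact: ext cuv.
move=> v /uniform_closureP clv.
have hu n : exists u : compactification W -> R, continuous u /\
    forall x, `|u (e x) - v x| <= 2^-1 ^+ n.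
  have [|_ [_ [u cu <-]] uv] := clv (2^-1 ^+ n); first by rewrite exprn_gt0.
  by exists u.
have [u uP] := choice hu.
have cu n : continuous (u n) by have [] := uP n.
have uv n x := (uP n).2 x.
(* The extensions approximate [v] only on the image of [X]; by density they are uniformly Cauchy
   everywhere. Their limit is then obtained as the supremum of [u n - 2^-1 ^+ n]. *)
have uu n m y : u n y <= u m y + (2^-1 ^+ n + 2^-1 ^+ m).
  apply: near_range => // x; have := uv n x; have := uv m x.
  by rewrite !ler_norml => /andP[? ?] /andP[? ?]; lra.
pose S y := [set u n y - 2^-1 ^+ n | n in [set: nat]].
pose g y := sup (S y).
have S0 y : S y !=set0 by exists (u 0%N y - 2^-1 ^+ 0), 0%N.
have gu n y : g y <= u n y + 2^-1 ^+ n.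
  by apply: ge_sup => // _ [m _ <-]; have := uu m n y; lra.
have ug n y : u n y - 2^-1 ^+ n <= g y.
  apply: sup_upper_bound; last by exists n.
  split=> //; exists (u 0%N y + 2^-1 ^+ 0) => _ [m _ <-].
  by have := uu m 0%N y; lra.
have cg : continuous g.
  apply: continuous_realP => y d d0.
  have [|n nd] := @exp_half_lt R (d / 3); first by rewrite divr_gt0.
  have d3 : 0 < d / 3 by rewrite divr_gt0.
  have := near_dist y (cu n) d3; apply: filterS => z; rewrite !ler_norml.
  move=> /andP[? ?]; have := gu n y; have := gu n z; have := ug n y.
  by have := ug n z => ? ? ? ?; apply/andP; split; lra.
rewrite (_ : v = g \o e); first exact: ext.
apply/funext => x /=; apply/eqP; rewrite -subr_eq0 -normr_le0.
apply/ler_addgt0Pr => d d0; rewrite add0r.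
have [|n nd] := @exp_half_lt R (d / 2); first by rewrite divr_gt0.
have := uv n x; have := gu n (e x); have := ug n (e x).
by rewrite !ler_norml => ? ? /andP[? ?]; apply/andP; split; lra.
Qed.

(** Extension by 0 is continuous: the image of [X] is open, and points outside it have a
    neighbourhood off the closed image of the support, where the extension vanishes. *)
Lemma compactly_supported_extendable (u : X -> R) :
  compactly_supported u -> extendable_functions e u.
Proof.
move=> [cu cK]; set K := closure _ in cK.
pose v (y : compactification W) :=
  if pselect (exists x, e x = y) is left h then u (projT1 (cid h)) else 0.
have ve x : v (e x) = u x.
  rewrite /v; case: pselect => [h|]; last by case; exists x.
  by congr u; apply: (embedding_inj hW); exact: (projT2 (cid h)).
have v0 y : ~ (e @` K) y -> v y = 0.
  rewrite /v; case: pselect => // h nK; apply: contrapT => /eqP ux.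
  apply: nK; exists (projT1 (cid h)); last exact: (projT2 (cid h)).
  exact: subset_closure.
have cv : continuous v.
  apply: continuous_realP => y d d0.
  have [[x _ <-]|ny] := pselect (range e y); last first.
    have : nbhs y (~` (e @` K)).
      apply: open_nbhs_nbhs; split.
        by apply: closed_openC; exact: closed_embedding_compact.
      by move=> [x _ xy]; apply: ny; exists x.
    have nKy : ~ (e @` K) y by move=> [x _ xy]; apply: ny; exists x.
    by apply: filterS => z nKz; rewrite !v0// subrr normr0 ltW.
  have : nbhs x [set z | `|u z - u x| <= d] by exact: (near_dist x cu d0).
  rewrite nbhsE => -[U [oU Ux] Ud].
  have : nbhs (e x) (e @` U).
    by apply: open_nbhs_nbhs; split; [exact: open_embedding|exists x].
  by apply: filterS => _ [z Uz <-]; rewrite !ve; exact: Ud.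
split; last by exists v => //; apply/funext => x; exact: ve.
split=> //; apply/bounded_funP.
have [M _ vM] := compact_bounded cptY cv; exists M => x.
by rewrite -ve; exact: vM.
Qed.

(** A closed algebra [A] containing [G] contains the coordinates. They separate the points of the
    compactification, so Stone-Weierstrass applies to the functions whose restriction lies in
    [A]. *)
Lemma extendable_functionsE (G : set (X -> R)) :
  G `<=` extendable_functions e ->
  W `<=` generated_closed_subalgebra G ->
  extendable_functions e = generated_closed_subalgebra G.
Proof.
move=> Gext WG; apply/seteqP; split; last first.
  by move=> u; apply; split=> //; exact: extendable_closed_subalgebra.
move=> _ [_ [v cv <-]] A [clA GA].
have WA w : W w -> A w by move=> /WG; apply.
have [Abc Acst Aadd Amul Aclosed] := clA.
pose B := [set v : compactification W -> R | continuous v /\ A (v \o e)].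
suff : B v by case.
apply: stone_weierstrass cv => //.
- by move=> u [].
- by move=> c; split; [exact: cst_continuous|exact: Acst].
- move=> f g [cf Af] [cg Ag]; split; last exact: Aadd.
  by move=> y; exact: (cvgD (cf y) (cg y)).
- move=> f g [cf Af] [cg Ag]; split; last exact: Amul.
  by move=> y; exact: (cvgM (cf y) (cg y)).
- move=> f cf happ; split=> //; apply: Aclosed.
  apply/uniform_closureP => d /happ [g [_ Ag] gf].
  by exists (g \o e) => // x; exact: gf.
- move=> y z yz; apply: contrapT => h; apply: yz; apply: coord_inj => i.
  apply: contrapT => ne; apply: h; exists (coord i) => //; split.
    exact: continuous_coord.
  by apply: WA; exact: set_valP.
Qed.

End compactification_algebra.

(** * Metrizability *)

Section metrizability.
Context {R : realType}.

Lemma metric_type_of_distance (T : Type) (d : T -> T -> R) :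
  (forall x, d x x = 0) -> (forall x y, d x y = 0 -> x = y) ->
  (forall x y, d x y = d y x) ->
  (forall y x z, d x z <= d x y + d y z) ->
  exists (M : metricType R) (f : T -> M), bijective f /\
    forall x y, mdist (f x) (f y) = d x y.
Proof.
move=> dxx d0 dC dD.
pose mx := isMetric.Build R {classic T} dxx d0 dC dD.
pose M : metricType R := HB.pack {classic T} mx.
by exists M, (fun x => x); split=> //; exists (fun x => x).
Qed.

Lemma continuous_metricP (Y : topologicalType) (M : metricType R) (f : Y -> M) :
  (forall y e, 0 < e -> \forall z \near y, mdist (f y) (f z) < e) ->
  continuous f.
Proof.
by move=> h y; apply/cvg_ballP => e e0; rewrite ballEmdist; exact: h.
Qed.

Lemma compact_bijection_homeomorphism (Y Z : topologicalType) (f : Y -> Z) :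
  compact [set: Y] -> hausdorff_space Z -> continuous f -> bijective f ->
  homeomorphism f.
Proof.
move=> cY hZ cf [g fg gf]; split=> //; exists g; split=> //.
apply/continuous_closedP => A clA.
rewrite (_ : g @^-1` A = f @` A); last first.
  by apply/seteqP; split=> [z Az|_ [y Ay <-]]; [exists (g z)|rewrite /= fg].
apply: compact_closed => //; apply: continuous_compact.
  exact: continuous_subspaceT.
exact: subclosed_compact clA cY _.
Qed.

(** The distance is the supremum of the differences of the [u i], capped by [2^-1 ^+ c i]. It is
    continuous, so the identity is a continuous bijection from a compact space onto a Hausdorff
    one. *)
Lemma countable_separating_metrizable (Y : topologicalType) (I : Type)
    (c : I -> nat) (u : I -> Y -> R) :
  injective c -> (forall i, continuous (u i)) ->
  (forall y z, (forall i, u i y = u i z) -> y = z) -> compact [set: Y] ->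
  metrizable R Y.
Proof.
move=> cinj cu u_inj cptY.
pose term i (y z : Y) : R :=
  Num.min (2^-1 ^+ c i) `|u i y - u i z|.
(* Adjoining 0 keeps the set nonempty when there is no index. *)
pose S y z := [set r | r = 0 \/ exists i, r = term i y z].
pose d y z := sup (S y z).
have t0 i y z : 0 <= term i y z by rewrite le_min normr_ge0 exprn_ge0.
have t1 i y z : term i y z <= 1.
  by rewrite ge_min exprn_ile1// invf_le1// ler1n.
have hS y z : has_sup (S y z).
  by split; [exists 0; left|exists 1 => _ [->|[i ->]]].
have td i y z : term i y z <= d y z.
  by apply: sup_upper_bound => //; right; exists i.
have dge0 y z : 0 <= d y z by apply: sup_upper_bound => //; left.
have dle a y z : 0 <= a -> (forall i, term i y z <= a) -> d y z <= a.
  by move=> a0 h; apply: ge_sup; [exact: (hS _ _).1|move=> _ [->|[i ->]]].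
have dxx y : d y y = 0.
  apply/eqP; rewrite eq_le dge0 andbT; apply: dle => // i.
  by rewrite /term subrr normr0 ge_min lexx orbT.
have d0 y z : d y z = 0 -> y = z.
  move=> yz; apply: u_inj => i; apply/eqP; rewrite -subr_eq0 -normr_le0.
  have := td i y z; rewrite yz ge_min => /orP[|//].
  by rewrite leNgt exprn_gt0.
have dC y z : d y z = d z y.
  rewrite /d; congr sup; apply/seteqP.
  by split=> r [->|[i ->]]; [left|right; exists i; rewrite /term distrC
    |left|right; exists i; rewrite /term distrC].
have dD y x z : d x z <= d x y + d y z.
  apply: dle => [|i]; first exact: addr_ge0.
  apply: le_trans (lerD (td i x y) (td i y z)).
  rewrite /term; set e := 2^-1 ^+ c i.
  have e0 : 0 <= e by rewrite exprn_ge0.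
  have := ler_distD (u i y) (u i x) (u i z).
  move: (normr_ge0 (u i x - u i y)) (normr_ge0 (u i y - u i z)).
  by rewrite !minEle; do 3 case: ifP; rewrite -?ltNge; lra.
have [M [f [bf fd]]] := metric_type_of_distance dxx d0 dC dD.
exists M, f; apply: compact_bijection_homeomorphism => //.
  exact: metric_hausdorff.
apply: continuous_metricP => y e e0; have e2 : 0 < e / 2 by rewrite divr_gt0.
have [n ne] := exp_half_lt e2.
(* Only finitely many indices have code below [n]; the terms of all others are capped by
   [2^-1 ^+ n]. *)
have : \forall z \near y, forall i, (c i < n)%N -> `|u i y - u i z| <= e / 2.
  elim: n {ne} => [|n IH]; first by apply: nearW => z i; rewrite ltn0.
  have [[i ci]|nci] := pselect (exists i, c i = n).
    have := near_dist y (cu i) e2; apply: filterS2 IH.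
    move=> z hz iz j; rewrite ltnS leq_eqVlt => /predU1P[jn|]; last exact: hz.
    by rewrite (cinj j i) ?ci// distrC.
  apply: filterS IH => z hz j; rewrite ltnS leq_eqVlt => /predU1P[jn|]; last exact: hz.
  by exfalso; apply: nci; exists j.
apply: filterS => z hz; rewrite fd.
apply: (@le_lt_trans _ _ (e / 2)); last by lra.
apply: dle => [|i]; first exact: ltW.
rewrite ge_min; have [ci|ci] := ltnP (c i) n; first by rewrite hz ?orbT.
apply/orP; left; apply: le_trans (ltW ne).
by apply: ler_wiXn2l => //; rewrite ?invr_ge0// invf_le1// ler1n.
Qed.

Lemma compactification_metrizable (X : topologicalType) (W : set (X -> R)) :
  coordinate_family W -> countable W -> metrizable R (compactification W).
Proof.
move=> hW /countable_injP[c cinj].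
apply: (@countable_separating_metrizable _ (coordinate_index W)
  (fun i => c (set_val i)) (@coord R X W)).
- by move=> i j /cinj h; apply: val_inj; apply: h; exact: valP.
- exact: continuous_coord.
- exact: coord_inj.
- exact: compactification_compact.
Qed.

Lemma countable_separation (X : topologicalType) (E : set (X * X))
    (H : set (X -> R)) :
  hausdorff_space X -> locally_compact [set: X] -> sigma_compact X ->
  metrizable R X -> closed E -> (forall h, H h -> continuous h) ->
  (forall x y, ~ E (x, y) -> exists2 h, H h & h y < h x) ->
  exists2 H', countable H' &
    H' `<=` H /\ forall x y, ~ E (x, y) -> exists2 h, H' h & h y < h x.
Proof.
move=> hausX lcX scX [M [f [cf [g [fg gf cg]]]]] clE cH sepH.
have [K [_ cK KS KT]] := compact_exhaustion lcX scX.
have leK m n : (m <= n)%N -> K m `<=` K n.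
  elim: n => [|n IH]; first by rewrite leqn0 => /eqP ->.
  rewrite leq_eqVlt => /predU1P[->//|/IH k] x /k /KS; exact: interior_subset.
(* The pairs at distance at least [2^-1 ^+ n] from [E]. Within [K n] times [K n] finitely many
   functions separate them, and every pair outside [E] is of this kind for large [n]. *)
pose far n (p : X * X) := forall q, E q ->
  ~ (ball (f q.1) (2^-1 ^+ n) (f p.1) /\ ball (f q.2) (2^-1 ^+ n) (f p.2)).
pose F := filter_from (fun A : set (X -> R) => finite_set A /\ A `<=` H)
  (fun A => [set B | A `<=` B]).
have FF : Filter F.
  apply: filter_from_filter; first by exists set0; split; [exact: finite_set0|exact: sub0set].
  move=> A B [fA AH] [fB BH]; exists (A `|` B).
    by split; [rewrite finite_setU|move=> h [/AH|/BH]].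
  by move=> C ABC; split=> h ?; apply: ABC; [left|right].
have fin n : exists A : set (X -> R), [/\ finite_set A, A `<=` H &
    forall p, K n p.1 -> K n p.2 -> far n p -> exists2 h, A h & h p.2 < h p.1].
  have /compact_near_coveringP cKK := compact_setX (cK n) (cK n).
  have [p _|A [fA AH] AP] :=
    cKK _ F (fun A p => far n p -> exists2 h, A h & h p.2 < h p.1) FF; last first.
    by exists A; split=> // p K1 K2; apply: (AP A).
  have r0 : 0 < (2^-1 : R) ^+ n by rewrite exprn_gt0.
  (* Around a point of [E] no pair is [far n], so nothing has to be separated there; around another
     point one function works, with a third of its gap as tolerance. *)
  have [Ep|nEp] := pselect (E p).
    have nf (x : X) : nbhs x (f @^-1` ball (f x) (2^-1 ^+ n)).
      by apply: cf; exact: nbhsx_ballx.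
    exists (f @^-1` ball (f p.1) (2^-1 ^+ n) `*` f @^-1` ball (f p.2) (2^-1 ^+ n), setT).
      split; last exact: filterT.
      by exists (f @^-1` ball (f p.1) (2^-1 ^+ n), f @^-1` ball (f p.2) (2^-1 ^+ n)).
    by move=> [q A] /= [[q1 q2] _] /(_ p Ep); case.
  have [h Hh hp] : exists2 h, H h & h p.2 < h p.1.
    by apply: sepH; rewrite -surjective_pairing.
  have e0 : 0 < (h p.1 - h p.2) / 3 by rewrite divr_gt0// subr_gt0.
  exists ([set x | `|h x - h p.1| <= (h p.1 - h p.2) / 3] `*`
          [set x | `|h x - h p.2| <= (h p.1 - h p.2) / 3], [set A | A h]).
    split; last by exists [set h]; [split=> // _ ->|move=> A; apply].
    exists ([set x | `|h x - h p.1| <= (h p.1 - h p.2) / 3],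
          [set x | `|h x - h p.2| <= (h p.1 - h p.2) / 3]) => //.
    by split; [exact: (near_dist _ (cH h Hh) e0)|exact: (near_dist _ (cH h Hh) e0)].
  move=> [q A] /= [[+ +] Ah] _; rewrite !ler_norml => /andP[? ?] /andP[? ?].
  by exists h => //; lra.
have [A AP] := choice fin.
exists (\bigcup_n A n).
  by apply: bigcup_countable => // n _; apply: finite_set_countable; have [] := AP n.
split=> [h [n _ Ah]|x y nE]; first by have [_ AH _] := AP n; exact: AH.
have : nbhs (x, y) (~` E).
  by apply: open_nbhs_nbhs; split=> //; exact: closed_openC.
move=> [[P Q] /= [nP nQ] PQ].
have ballg z (B : set X) : nbhs z B ->
    exists n, forall m z', (n <= m)%N -> ball (f z') (2^-1 ^+ m) (f z) -> B z'.
  move=> nB; have := cg (f z); rewrite /continuous_at fg => /(_ _ nB).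
  move=> /nbhs_ballP[r /= r0 rB]; have [n nr] := exp_half_lt r0.
  exists n => m z' nm /ball_sym h; rewrite -[z']fg; apply: rB.
  apply: le_ball h; apply: le_trans (ltW nr).
  by apply: ler_wiXn2l => //; rewrite ?invr_ge0// invf_le1// ler1n.
have [n1 h1] := ballg _ _ nP; have [n2 h2] := ballg _ _ nQ.
have [m1 Kx] := KT x; have [m2 Ky] := KT y.
pose n := maxn (maxn n1 n2) (maxn m1 m2).
have [_ _ /(_ (x, y))] := AP n; case=> /=.
- by apply: leK Kx; rewrite /n !leq_max leqnn !orbT.
- by apply: leK Ky; rewrite /n !leq_max leqnn !orbT.
- move=> q Eq [q1 q2]; apply: (PQ q) => //; split.
    by apply: h1 q1; rewrite /n !leq_max leqnn.
  by apply: h2 q2; rewrite /n !leq_max leqnn !orbT.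
by move=> h Ah hyx; exists h => //; exists n.
Qed.

End metrizability.

(** * Lyapunov function compactifications *)

Section generalized_orbit_preorder.
Context {R : realType} {X : topologicalType} (phi : semiflow R X).

Local Notation G := (generalized_orbit_relation phi).

Lemma generalized_orbit_closed_transitive : closed_transitive G.
Proof.
split; first by apply: closed_bigI => F [[clF _] _].
move=> x y z xy yz F FP; have [[_ tF] _] := FP; exact: tF (xy F FP) (yz F FP).
Qed.

(** Time is cut into steps of length at most 1, which transitivity composes. *)
Lemma generalized_orbit_semiflow x t : 0 <= t -> G (x, phi t x).
Proof.
move=> t0; have [_ tG] := generalized_orbit_closed_transitive.
have unit s y : 0 <= s <= 1 -> G (y, phi s y).
  by move=> s01 F [_ UF]; apply: UF; exists s.
suff h n : forall t, 0 <= t <= n%:R -> G (x, phi t x).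
  apply: (h (Num.bound t)); rewrite t0 /=.
  by apply/ltW/archi_boundP.
elim: n => [|n IH] {t0}t /andP[t0 tn].
  by apply: unit; rewrite t0 (le_trans tn)// ler01.
have [t1|t1] := leP t 1; first by apply: unit; rewrite t0 t1.
apply: (tG _ (phi (t - 1) x)).
  by apply: IH; rewrite subr_ge0 ltW//= lerBlDr natr1.
have u1 : 0 <= (1 : R) <= 1 by rewrite lexx ler01.
have := unit 1 (phi (t - 1) x) u1; rewrite semiflowD; [|lra|exact: ler01].
by rewrite (addrC 1) subrK.
Qed.

Lemma generalized_orbit_preorder : preorder_relation G.
Proof.
split; last exact: generalized_orbit_closed_transitive.2.
by move=> x; have := generalized_orbit_semiflow x (lexx 0); rewrite semiflow0.
Qed.

(** The relation [u p.1 <= u p.2] is closed, transitive and contains the unit orbits, so minimality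
    of the generalized orbit relation applies. *)
Lemma generalized_orbit_le (u : X -> R) : continuous u ->
  (forall x t, 0 <= t -> u x <= u (phi t x)) -> forall x y, G (x, y) -> u x <= u y.
Proof.
move=> cu mu x y xy; apply: (xy [set p : X * X | u p.1 <= u p.2]).
split; last first.
  by move=> [z w] /= [t /andP[t0 _] /= <-]; exact: mu.
split; last by move=> a b c /= ab bc; exact: le_trans ab bc.
rewrite (_ : [set p : X * X | _] =
  (fun p : X * X => u p.2 - u p.1) @^-1` [set r | 0 <= r]); last first.
  by apply/seteqP; split=> p /=; rewrite subr_ge0.
apply: preimage_closed; last exact: closed_ge.
move=> p _; apply: cvgB.
  by apply: (cvg_comp _ _ (@cvg_snd _ _ _ _ _)); exact: cu.
by apply: (cvg_comp _ _ (@cvg_fst _ _ _ _ _)); exact: cu.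
Qed.

End generalized_orbit_preorder.

Lemma countable_image (T U : Type) (f : T -> U) (A : set T) :
  countable A -> countable (f @` A).
Proof. by move=> cA; exact: card_le_trans (card_image_le f A) cA. Qed.

Lemma countable_setU (T : Type) (A B : set T) :
  countable A -> countable B -> countable (A `|` B).
Proof.
move=> cA cB; rewrite -bigcup2E; apply: bigcup_countable => // -[|[|n]] _ //=.
Qed.

(** * The compactification built from separating families *)

Section compactification_of_families.
Context {R : realType} {X : topologicalType}.
Hypothesis hausX : hausdorff_space X.
Variable phi : semiflow R X.

Variables LL HH : set (X -> R).
Hypothesis LL_cont : forall L, LL L -> continuous L.
Hypothesis LL_bound : forall L, LL L -> forall x, 0 <= L x <= 1.
Hypothesis LL_mono : forall L, LL L -> forall x y,
  generalized_orbit_relation phi (x, y) -> L x <= L y.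
Hypothesis LL_sep : forall x y, ~ generalized_orbit_relation phi (x, y) ->
  exists2 L, LL L & L y < L x.
Hypothesis HH_cont : forall h, HH h -> continuous h.
Hypothesis HH_bound : forall h, HH h -> forall x, 0 <= h x <= 1.
Hypothesis HH_sep : forall x y, x <> y -> exists2 h, HH h & h y < h x.

Variable psi : R -> X -> X.
Hypothesis flow_psi : continuous_flow psi.
Hypothesis psi_phi : forall t x, 0 <= t -> psi t x = phi t x.

Variable T : X -> R.
Hypothesis cT : continuous T.
Hypothesis T1 : forall x, 1 <= T x.
Hypothesis T_proper : proper_height T.
Hypothesis T_lip : forall t x, T (psi t x) <= T x + `|t|.

(** The shift to [k.+1] provides the positive cost required by the speed estimate. *)
Let slow (k : nat) (L : X -> R) := slowed psi T L k.+1.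
Let cutoff (n : nat) (h : X -> R) (x : X) : R := Num.max 0 (n%:R - T x) * h x.
(** The constant turns truncations of [T] itself into coordinates: they separate points of different
    escape time and are positive only within compact sets. *)
Let HH1 := HH `|` [set cst 1].
Let W := \bigcup_k (slow k @` LL) `|` \bigcup_n (cutoff n @` HH1).

Let LL_flow L : LL L -> flow_monotone psi L.
Proof.
move=> LLL x t t0; rewrite psi_phi//; apply: LL_mono => //.
exact: generalized_orbit_semiflow.
Qed.

Let cslow k L : LL L -> continuous (slow k L).
Proof.
by move=> LLL; apply: continuous_slowed => //; [exact: LL_cont|exact: LL_bound].
Qed.

Let slow_mono k L : LL L -> flow_monotone psi (slow k L).
Proof.
by move=> LLL; apply: slowed_monotone => //; [exact: LL_bound|exact: LL_flow].
Qed.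

Let slow_bound k L x : LL L -> 0 <= slow k L x <= 1.
Proof. by move=> LLL; apply: slowed_bounds => //; exact: LL_bound. Qed.

Let slow_speed k L x t : LL L -> 0 <= t ->
  `|slow k L (psi t x) - slow k L x| <= 2 * k.+1%:R * t / T x.
Proof.
move=> LLL t0; rewrite ger0_norm ?subr_ge0; last exact: slow_mono.
rewrite lerBlDl; apply: slowed_speed => //; [exact: LL_bound|exact: LL_flow].
Qed.

Let HH1_cont h : HH1 h -> continuous h.
Proof. by move=> [/HH_cont//|->]; exact: cst_continuous. Qed.

Let HH1_bound h x : HH1 h -> 0 <= h x <= 1.
Proof. by move=> [/HH_bound//|->]; rewrite /cst /= ler01 lexx. Qed.

Let ccutoff n h : HH1 h -> continuous (cutoff n h).
Proof.
move=> hh x; apply: cvgM; last exact: HH1_cont.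
apply: (@continuous_max _ _ (cst 0) (fun x => n%:R - T x)); first exact: cvg_cst.
by apply: cvgB; [exact: cvg_cst|exact: cT].
Qed.

Let cutoff0 n h x : n%:R <= T x -> cutoff n h x = 0.
Proof. by move=> nT; rewrite /cutoff max_l ?mul0r// subr_le0. Qed.

Let cutoffE n h x : T x <= n%:R -> cutoff n h x = (n%:R - T x) * h x.
Proof. by move=> nT; rewrite /cutoff max_r// subr_ge0. Qed.

Let cutoff_bound n h x : HH1 h -> `|cutoff n h x| <= n%:R.
Proof.
move=> hh; have /andP[h0 h1] := HH1_bound x hh.
have [nT|/ltW nT] := leP n%:R (T x); first by rewrite cutoff0// normr0.
rewrite cutoffE// ger0_norm ?mulr_ge0 ?subr_ge0//.
have := T1 x => t1; rewrite -[leRHS]mulr1 ler_pM ?subr_ge0//; lra.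
Qed.

Let cutoff_proper n h : exists2 K, compact K & forall x, cutoff n h x != 0 -> K x.
Proof.
have [K cK TK] := T_proper n%:R; exists K => // x.
have [nT|/ltW nT] := leP n%:R (T x); first by rewrite cutoff0// eqxx.
by move=> _; exact: TK.
Qed.

Let boundP x : T x < (Num.bound (T x))%:R.
Proof. by apply: archi_boundP; apply: le_trans (T1 x). Qed.

Let hW : coordinate_family W.
Proof.
split.
- by move=> _ [[k _ [L LLL <-]]|[n _ [h hh <-]]]; [exact: cslow|exact: ccutoff].
- move=> _ [[k _ [L LLL <-]]|[n _ [h hh <-]]].
    exists 1 => x; have /andP[? ?] := slow_bound k x LLL.
    by rewrite ger0_norm.
  by exists n%:R => x; exact: cutoff_bound.
- move=> x y xy; pose n := maxn (Num.bound (T x)) (Num.bound (T y)).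
  have Tx : T x < n%:R.
    by apply: lt_le_trans (boundP x) _; rewrite ler_nat leq_maxl.
  have Ty : T y < n%:R.
    by apply: lt_le_trans (boundP y) _; rewrite ler_nat leq_maxr.
  (* For equal escape times the cutoff factor is common and nonzero, so a separating [h] does it;
     otherwise the cutoff of 1 separates. *)
  have [TT|TT] := eqVneq (T x) (T y).
    have [h hh hyx] := HH_sep xy; exists (cutoff n h).
      by right; exists n => //; exists h => //; left.
    rewrite !cutoffE ?ltW// TT => /mulfI; rewrite subr_eq0 gt_eqF// => /(_ isT).
    by move=> E; rewrite E ltxx in hyx.
  exists (cutoff n (cst 1)).
    by right; exists n => //; exists (cst 1) => //; right.
  rewrite !cutoffE ?ltW// !mulr1 => E; move: TT; apply/negP/negPn/eqP; lra.
- move=> x; exists (cutoff (Num.bound (T x)) (cst 1)); split.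
  + by right; exists (Num.bound (T x)) => //; exists (cst 1) => //; right.
  + by rewrite cutoffE ?mulr1 ?subr_gt0// ltW.
  + have [K cK KP] := cutoff_proper (Num.bound (T x)) (cst 1).
    by exists K => // z z0; apply: KP; rewrite gt_eqF.
Qed.

Let psi_T t x : T x - `|t| <= T (psi t x).
Proof.
have [_ psi0 psiD] := flow_psi; have := T_lip (- t) (psi t x).
by rewrite psiD addNr psi0 normrN; lra.
Qed.

Let slow_W w tau e : W w -> 0 < e -> exists2 K, compact K &
  forall x s, ~ K x -> `|s| <= tau -> `|w (psi s x) - w x| <= e.
Proof.
have [_ psi0 psiD] := flow_psi.
move=> [[k _ [L LLL <-]]|[n _ [h hh <-]]] e0.
  (* Once [T] exceeds [a], the speed estimate bounds the change over a time up to [|tau|] by [e].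
     Requiring [a + |tau|] at [x] keeps [T] above [a] along the orbit segment. *)
  pose a := 2 * k.+1%:R * `|tau| / e; have a0 : 0 <= a.
    by rewrite divr_ge0 ?mulr_ge0// ltW.
  have [K cK TK] := T_proper (a + `|tau|); exists K => // x s nKx stau.
  have Tx : a + `|tau| < T x by rewrite ltNge; apply/negP => /TK.
  have tt : tau <= `|tau| by exact: ler_norm.
  have sl z t : 0 <= t -> t <= `|tau| -> a < T z ->
      `|slow k L (psi t z) - slow k L z| <= e.
    move=> t0 tt' az; apply: le_trans (slow_speed _ _ LLL t0) _.
    have Tz : 0 < T z by apply: lt_le_trans (T1 z).
    rewrite ler_pdivrMr//; apply: (@le_trans _ _ (e * a)); last first.
      by rewrite ler_pM2l// ltW.
    rewrite /a mulrCA divff ?gt_eqF// mulr1.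
    by apply: ler_wpM2l => //; rewrite mulr_ge0.
  have [s0|s0] := leP 0 s.
    by apply: sl => //; [rewrite -(ger0_norm s0); lra|have := normr_ge0 tau; lra].
  (* For negative [s] the forward estimate starts from [psi s x] instead. *)
  have := sl (psi s x) (- s); rewrite psiD addNr psi0 distrC; apply.
  - by lra.
  - by rewrite -(ltr0_norm s0); lra.
  - by have := psi_T s x; lra.
have [K cK TK] := T_proper (n%:R + `|tau|); exists K => // x s nKx stau.
have Tx : n%:R + `|tau| < T x by rewrite ltNge; apply/negP => /TK.
have tt : tau <= `|tau| by exact: ler_norm.
rewrite !cutoff0 ?subrr ?normr0; first exact: ltW.
  by have := normr_ge0 tau; lra.
by have := psi_T s x; lra.
Qed.

(** Composition with all [phi t] gives invariance. These functions extend through the extended flow,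
    so only the [slow k L] enter [W], which is countable when [LL] and [HH] are. *)
Let LLphi : set (X -> R) := [set u | exists L k t,
  [/\ LL L, 0 <= t & u = slow k L \o phi t]].

Let LLphi_sufficient : sufficient_set phi LLphi.
Proof.
have [_ psi0 psiD] := flow_psi.
have cphi t : 0 <= t -> continuous (phi t).
  move=> t0; have [+ _] := flow_homeomorphism t flow_psi.
  by rewrite (_ : psi t = phi t)//; apply/funext => x; exact: psi_phi.
have phiC s t x : 0 <= s -> 0 <= t -> phi t (phi s x) = psi s (psi t x).
  by move=> s0 t0; rewrite -!psi_phi// !psiD addrC.
have lyap u : LLphi u -> phi_uniform phi u /\ lyapunov_function phi u.
  move=> [L [k [t [LLL t0 ->]]]]; split.
    (* As [T] is at least 1, the speed is at most [2 * k.+1] everywhere. *)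
    move=> e e0; exists (e / (2 * k.+1%:R)); first by rewrite divr_gt0.
    move=> s x /andP[s0 se] /=.
    rewrite phiC// -psi_phi//.
    apply: le_trans (slow_speed _ _ LLL s0) _.
    have Tz : 0 < T (psi t x) by apply: lt_le_trans (T1 _).
    rewrite ler_pdivrMr//; apply: (@le_trans _ _ e).
      by move: se; rewrite ler_pdivlMr// mulrC.
    by rewrite ler_peMr// ltW.
  split; last first.
    move=> x s s0 /=; rewrite phiC// -(psi_phi x t0).
    exact: slow_mono.
  split.
    move=> x; exact: (continuous_comp (cphi t t0 x) (@cslow k L LLL _)).
  apply/bounded_funP; exists 1 => x.
  by have /andP[? ?] := slow_bound k (phi t x) LLL; rewrite ger0_norm.
split=> //; apply/seteqP; split=> [[x y] h|[x y] xy u LLu /=]; last first.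
  have [_ [[cu _] mu]] := lyap u LLu; exact: generalized_orbit_le xy.
apply: contrapT => /LL_sep[L LLL Lyx].
have [k] := slowed_separates flow_psi T (LL_cont LLL) (LL_bound LLL)
  (LL_flow LLL) Lyx.
have := h (slow k L \o phi 0); rewrite /= !semiflow0 leNgt => /(_ _)/negP.
by apply; exists L, k, 0.
Qed.

Let psihat_flow := extended_flow_flow hausX hW flow_psi slow_W.

Lemma lyapunov_compactification_of_families :
  exists C : lyapunov_compactification phi,
  [/\ reversible (lc_semiflow C),
      ~` range (lc_emb C) `<=` fixed_points (lc_semiflow C)
    & countable LL -> countable HH -> metrizable R (lc_space C)].
Proof.
have algebra : exists LL' : set (X -> R),
  [/\ sufficient_set phi LL', plus_invariant phi LL'
    & extendable_functions (@embedding R X W) =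
        generated_closed_subalgebra (LL' `|` compactly_supported)].
  exists LLphi; split=> //.
    move=> _ t [L [k [s [LLL s0 ->]]]] t0; exists L, k, (s + t); split=> //.
      exact: addr_ge0.
    by apply/funext => x /=; rewrite semiflowD.
  apply: extendable_functionsE => //.
    move=> u [uLL|]; last exact: compactly_supported_extendable.
    have [_ [bu _]] := LLphi_sufficient.1 _ uLL; split=> //.
    have [L [k [t [LLL t0 ->]]]] := uLL.
    have Wk : W (slow k L) by left; exists k => //; exists L.
    pose i : coordinate_index W := exist _ (slow k L) (mem_set Wk).
    have [ct _] := flow_homeomorphism t psihat_flow.
    exists (@coord R X W i \o extended_flow psi t).
      by move=> y; exact: (continuous_comp (ct y) (@continuous_coord R X W i _)).
    by apply/funext => x /=; rewrite extended_flow_embedding// coord_embedding psi_phi.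
  (* A slowed function is the member of [LLphi] at time 0; a cutoff has compact support. *)
  move=> w Ww A [_ GA]; apply: GA; case: Ww => [[k _ [L LLL <-]]|[n _ [h hh <-]]].
    left; exists L, k, 0; split=> //; by apply/funext => x /=; rewrite semiflow0.
  right; split; first exact: ccutoff.
  have [K cK KP] := cutoff_proper n h.
  apply: (subclosed_compact _ cK); first exact: closed_closure.
  have /closure_id -> := compact_closed hausX cK.
  by apply: closureS => x; exact: KP.
pose C : lyapunov_compactification phi := @LyapunovCompactification R X phi
  (compactification W) (@embedding R X W) (semiflow_of_flow psihat_flow)
  (embedding_proper_compactification hausX hW) algebra
  (fun t x t0 => etrans (extended_flow_embedding hW psi t x)
     (congr1 _ (psi_phi x t0))).
exists C; split.
- exact: (flow_homeomorphism 1 psihat_flow).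
- by move=> y ny t t0; exact: extended_flow_fixed.
- move=> cLL cHH; apply: compactification_metrizable => //.
  apply: countable_setU; apply: bigcup_countable => // n _;
    apply: countable_image => //.
  by apply: countable_setU => //; exact: countable1.
Qed.

End compactification_of_families.

Theorem theorem5p8 (R : realType) (X : topologicalType)
  (hausX : hausdorff_space X) (lcX : locally_compact [set: X])
  (scX : sigma_compact X)
  (phi : semiflow R X) (rev_phi : reversible phi) :
  (exists C : lyapunov_compactification phi,
     reversible (lc_semiflow C) /\
     ~` range (lc_emb C) `<=` fixed_points (lc_semiflow C)) /\
  (metrizable R X ->
   exists C : lyapunov_compactification phi,
     [/\ reversible (lc_semiflow C),
         ~` range (lc_emb C) `<=` fixed_points (lc_semiflow C)
       & metrizable R (lc_space C)]).
Proof.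
have [psi [flow_psi psi_phi]] := reversible_flow rev_phi.
have [T [cT T1 pT lT]] := escape_time flow_psi hausX lcX scX.
pose G := generalized_orbit_relation phi.
have clG : closed G := (generalized_orbit_closed_transitive phi).1.
(* For the diagonal, monotonicity is no constraint, and the separation lemma yields the functions
   [h] that distinguish points of [X]. *)
pose D := [set p : X * X | p.1 = p.2].
have clD : closed D by exact: closed_diagonal.
have pD : preorder_relation D by split=> [//|x y z]; rewrite /D /= => -> ->.
pose monotone (E : set (X * X)) := [set L : X -> R | [/\ continuous L,
  forall x, 0 <= L x <= 1 & forall x y, E (x, y) -> L x <= L y]].
have sep E : closed E -> preorder_relation E -> forall x y, ~ E (x, y) ->
    exists2 L, monotone E L & L y < L x.
  move=> clE pE x y nxy.
  have [L [cL bL yx mL]] := nachbin_separation (R := R) hausX lcX scX clE pE nxy.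
  by exists L.
have sepG := sep G clG (generalized_orbit_preorder phi).
have sepD := sep D clD pD.
have main (LL HH : set (X -> R)) : LL `<=` monotone G -> HH `<=` monotone D ->
    (forall x y, ~ G (x, y) -> exists2 L, LL L & L y < L x) ->
    (forall x y, x <> y -> exists2 h, HH h & h y < h x) ->
    exists C : lyapunov_compactification phi,
    [/\ reversible (lc_semiflow C),
      ~` range (lc_emb C) `<=` fixed_points (lc_semiflow C)
    & countable LL -> countable HH -> metrizable R (lc_space C)].
  move=> LG HD LS HS.
  apply: (@lyapunov_compactification_of_families R X hausX phi LL HH
    _ _ _ LS _ _ HS psi flow_psi psi_phi T) => //.
  - by move=> L /LG[].
  - by move=> L /LG[].
  - by move=> L /LG[].
  - by move=> L /HD[].
  - by move=> L /HD[].
split.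
  (* In general all monotone functions are taken; in the metrizable case countable subfamilies that
     still separate. *)
  have [C [? ? _]] := main (monotone G) (monotone D) (fun _ => id) (fun _ => id) sepG sepD.
  by exists C.
move=> mX.
have cont E h : monotone E h -> continuous h by case.
have [LL cLL [LG LS]] :=
  countable_separation hausX lcX scX mX clG (@cont G) sepG.
have [HH cHH [HD HS]] :=
  countable_separation hausX lcX scX mX clD (@cont D) sepD.
have [C [? ? mC]] := main LL HH LG HD LS HS.
by exists C; split=> //; exact: mC.
Qed.
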